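(* Let $(X,w,\mu)$ be a locally finite weighted graph and let $d=d_\sigma$ be an intrinsic path metric such that $(X,d)$ is metrically complete. Then $$D(L)=\{u\in L^2(X,\mu)\mid\Delta u\in L^2(X,\mu)\},$$ and $L_c=\Delta|_{C_c(X)}$ is essentially self-adjoint and has a unique Markovian extension.
   Context: All functions are real valued. A weighted graph $(X,w,\mu)$ consists of a countably infinite discrete set $X$, a function $\mu:X\to(0,\infty)$ (viewed as a measure on $X$), and a symmetric function $w:X\times X\to[0,\infty)$ with $w(x,x)=0$ and $\sum_{y\in X}w(x,y)<\infty$ for all $x\in X$. Write $x\sim y$ ($x,y$ are neighbors) if $w(x,y)>0$. The graph is locally finite if every vertex has only finitely many neighbors. A path connecting $x$ and $y$ is a sequence $(x_0,\dots,x_n)$, $n\ge1$, with $x_0=x$, $x_n=y$, $x_i\sim x_{i+1}$. All weighted graphs are assumed connected: any two distinct points are connected by a path. Let $\sigma:X\times X\to[0,\infty)$ be symmetric with $\sigma(x,y)>0$ if and only if $x\sim y$. The path pseudo metric $d_\sigma$ is given by $d_\sigma(x,x)=0$ and, for $x\ne y$, $d_\sigma(x,y)=\inf l_\sigma((x_0,\dots,x_n))$ over all paths connecting $x$ and $y$, where $l_\sigma((x_0,\dots,x_n))=\sum_{i=0}^{n-1}\sigma(x_i,x_{i+1})$. On a locally finite graph this is a metric, and one speaks of a path metric. A pseudo metric $d$ is intrinsic if $\frac1{\mu(x)}\sum_{y\in X}w(x,y)d(x,y)^2\le1$ for all $x\in X$. $C(X)$ is the set of all functions $X\to\mathbb R$,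 $C_c(X)$ the finitely supported ones, and $L^2(X,\mu)$ has norm $\|u\|=(\sum_xu(x)^2\mu(x))^{1/2}$. For $f\in C(X)$ let $\widetilde Q(f)=\frac12\sum_{x,y\in X}w(x,y)(f(x)-f(y))^2\in[0,\infty]$ (with polarization) and $\|f\|_{\widetilde Q}=(\widetilde Q(f)+\|f\|^2)^{1/2}$. Let $D(Q)$ be the closure of $C_c(X)$ with respect to $\|\cdot\|_{\widetilde Q}$ in $\{f\in L^2(X,\mu)\mid\widetilde Q(f)<\infty\}$, and $Q$ the restriction of $\widetilde Q$ to $D(Q)$. $L$, with domain $D(L)$, is the non-negative self-adjoint operator on $L^2(X,\mu)$ associated with the closed form $(Q,D(Q))$. The formal Laplacian is $(\Delta f)(x)=\frac1{\mu(x)}\sum_{y\in X}w(x,y)(f(x)-f(y))$, which on a locally finite graph is defined for all $f\in C(X)$ and maps $C_c(X)$ to $C_c(X)$. A self-adjoint extension of $L_c$ is called Markovian if the quadratic form associated with it is a Dirichlet form on $L^2(X,\mu)$. *)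

(* Defs.v *)
From mathcomp Require Import all_boot all_order all_algebra.
From mathcomp Require Import all_classical all_reals all_analysis.

Set Implicit Arguments.
Unset Strict Implicit.
Unset Printing Implicit Defensive.
Import Order.TTheory GRing.Theory Num.Theory.
Local Open Scope classical_set_scope.
Local Open Scope ring_scope.

Definition adjacent (R : realType) (X : Type) (w : X -> X -> R) : rel X :=
  fun x y => 0 < w x y.

(* The path (x_0, ..., x_n), n >= 1, is encoded by its starting point x = x_0
   and the nonempty sequence p = [:: x_1; ...; x_n]. *)
Definition is_path (R : realType) (X : eqType) (w : X -> X -> R)
    (x y : X) (p : seq X) : Prop :=
  [/\ p != [::], path (adjacent w) x p & last x p = y].

Record weighted_graph (R : realType) (X : countType) := WeightedGraph {
  weight : X -> X -> R ;
  mass : X -> R ;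
  vertices_infinite : infinite_set [set: X] ;
  mass_gt0 : forall x, 0 < mass x ;
  weight_ge0 : forall x y, 0 <= weight x y ;
  weight_sym : forall x y, weight x y = weight y x ;
  weight_diag : forall x, weight x x = 0 ;
  weight_summable :
    forall x, (\esum_(y in [set: X]) (weight x y)%:E < +oo)%E ;
  graph_connected : forall x y, x <> y -> exists p, is_path weight x y p
}.

Definition locally_finite (R : realType) (X : countType)
    (G : weighted_graph R X) : Prop :=
  forall x, finite_set [set y | adjacent (weight G) x y].

Record edge_length (R : realType) (X : countType) (G : weighted_graph R X)
    (sigma : X -> X -> R) : Prop := EdgeLength {
  edge_length_ge0 : forall x y, 0 <= sigma x y ;
  edge_length_sym : forall x y, sigma x y = sigma y x ;
  edge_length_gt0 :
    forall x y, 0 < sigma x y <-> adjacent (weight G) x y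
}.

Definition path_length (R : realType) (X : Type) (sigma : X -> X -> R)
    (x : X) (p : seq X) : R :=
  \sum_(l <- pairmap sigma x p) l.

Definition path_metric (R : realType) (X : countType) (G : weighted_graph R X)
    (sigma : X -> X -> R) (x y : X) : R :=
  if x == y then 0
  else inf [set path_length sigma x p | p in is_path (weight G) x y].

Definition intrinsic (R : realType) (X : countType) (G : weighted_graph R X)
    (d : X -> X -> R) : Prop :=
  forall x, (((mass G x)^-1)%:E *
    (\esum_(y in [set: X]) (weight G x y * d x y ^+ 2)%:E) <= 1)%E.

Definition metrically_complete (R : realType) (X : Type)
    (d : X -> X -> R) : Prop :=
  forall x_ : nat -> X,
    (forall eps : R, 0 < eps -> exists N : nat, forall m n : nat,
       (N <= m)%N -> (N <= n)%N -> d (x_ m) (x_ n) < eps) ->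
    exists x : X, forall eps : R, 0 < eps -> exists N : nat, forall n : nat,
      (N <= n)%N -> d (x_ n) x < eps.

(* The sum of an absolutely summable real family (junk value otherwise). *)
Definition rsum (R : realType) (X : choiceType) (f : X -> R) : R :=
  fine (\esum_(x in [set: X]) (Num.max (f x) 0)%:E) -
  fine (\esum_(x in [set: X]) (Num.max (- f x) 0)%:E).

(* L^2(X,mu): since mu > 0 on a discrete space, its elements are functions. *)

Definition l2norm (R : realType) (X : countType) (mu : X -> R)
    (u : X -> R) : \bar R :=
  sqrte (\esum_(x in [set: X]) (u x ^+ 2 * mu x)%:E).

Definition L2 (R : realType) (X : countType) (mu : X -> R) : set (X -> R) :=
  [set u | (l2norm mu u < +oo)%E].

Definition ip (R : realType) (X : countType) (mu : X -> R)
    (u v : X -> R) : R :=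
  rsum (fun x => u x * v x * mu x).

Definition dense_in_L2 (R : realType) (X : countType) (mu : X -> R)
    (D : set (X -> R)) : Prop :=
  forall u, L2 mu u -> forall eps : R, 0 < eps ->
    exists2 v, D v & (l2norm mu (u \- v)%R < eps%:E)%E.

Definition subspace (R : realType) (X : Type) (D : set (X -> R)) : Prop :=
  [/\ D (fun=> 0),
      forall u v, D u -> D v -> D (u \+ v) &
      forall (a : R) u, D u -> D (a \*o u)].

(* An unbounded operator T is represented by its graph {(u, Tu) | u in D(T)},
   so that extension of operators is inclusion and equality of operators
   includes equality of domains. *)

Definition dom (X R : Type) (T : set ((X -> R) * (X -> R))) : set (X -> R) :=
  [set u | exists f, T (u, f)].

Definition is_operator (R : realType) (X : countType) (mu : X -> R)
    (T : set ((X -> R) * (X -> R))) : Prop :=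
  [/\ T `<=` L2 mu `*` L2 mu,
      T (fun=> 0, fun=> 0),
      forall u v f g, T (u, f) -> T (v, g) -> T (u \+ v, f \+ g),
      forall (a : R) u f, T (u, f) -> T (a \*o u, a \*o f) &
      forall u f g, T (u, f) -> T (u, g) -> f = g].

Definition adjoint (R : realType) (X : countType) (mu : X -> R)
    (T : set ((X -> R) * (X -> R))) : set ((X -> R) * (X -> R)) :=
  [set p | [/\ L2 mu p.1, L2 mu p.2 &
    forall u f, T (u, f) -> ip mu f p.1 = ip mu u p.2]].

Definition self_adjoint (R : realType) (X : countType) (mu : X -> R)
    (T : set ((X -> R) * (X -> R))) : Prop :=
  [/\ is_operator mu T, dense_in_L2 mu (dom T) & adjoint mu T = T].

Definition operator_closure (R : realType) (X : countType) (mu : X -> R)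
    (T : set ((X -> R) * (X -> R))) : set ((X -> R) * (X -> R)) :=
  [set p | [/\ L2 mu p.1, L2 mu p.2 &
    forall eps : R, 0 < eps -> exists2 q, T q &
      (l2norm mu (p.1 \- q.1)%R < eps%:E)%E /\
      (l2norm mu (p.2 \- q.2)%R < eps%:E)%E]].

Definition essentially_self_adjoint (R : realType) (X : countType)
    (mu : X -> R) (T : set ((X -> R) * (X -> R))) : Prop :=
  [/\ is_operator mu T, dense_in_L2 mu (dom T) &
      self_adjoint mu (operator_closure mu T)].

(* A symmetric form is a pair (q, D) of a bilinear map and its domain; the
   values of q outside D are irrelevant. *)

Definition form_norm (R : realType) (X : countType) (mu : X -> R)
    (q : (X -> R) -> (X -> R) -> R) (u : X -> R) : \bar R :=
  sqrte ((q u u)%:E + l2norm mu u ^+ 2)%E.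

Record closed_form (R : realType) (X : countType) (mu : X -> R)
    (q : (X -> R) -> (X -> R) -> R) (D : set (X -> R)) : Prop := ClosedForm {
  form_sub : D `<=` L2 mu ;
  form_subspace : subspace D ;
  form_dense : dense_in_L2 mu D ;
  form_sym : forall u v, D u -> D v -> q u v = q v u ;
  form_add : forall u v v', D u -> D v -> D v' ->
    q (v \+ v') u = q v u + q v' u ;
  form_scale : forall (a : R) u v, D u -> D v -> q (a \*o v) u = a * q v u ;
  form_ge0 : forall u, D u -> 0 <= q u u ;
  form_complete : forall u_ : nat -> X -> R,
    (forall n, D (u_ n)) ->
    (forall eps : R, 0 < eps -> exists N : nat, forall m n : nat,
       (N <= m)%N -> (N <= n)%N ->
       (form_norm mu q (u_ m \- u_ n)%R < eps%:E)%E) ->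
    exists2 u, D u & forall eps : R, 0 < eps -> exists N : nat,
      forall n : nat, (N <= n)%N -> (form_norm mu q (u_ n \- u)%R < eps%:E)%E
}.

Definition normal_contraction (R : realType) (C : R -> R) : Prop :=
  C 0 = 0 /\ forall s t, `|C s - C t| <= `|s - t|.

Definition dirichlet_form (R : realType) (X : countType) (mu : X -> R)
    (q : (X -> R) -> (X -> R) -> R) (D : set (X -> R)) : Prop :=
  closed_form mu q D /\
  forall (C : R -> R) u, normal_contraction C -> D u ->
    D (C \o u) /\ q (C \o u) (C \o u) <= q u u.

(* The operator associated with a closed form (q, D): Tu = f iff u is in D
   and q(u,v) = <f,v> for all v in D. *)
Definition form_operator (R : realType) (X : countType) (mu : X -> R)
    (q : (X -> R) -> (X -> R) -> R) (D : set (X -> R)) :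
    set ((X -> R) * (X -> R)) :=
  [set p | [/\ D p.1, L2 mu p.2 & forall v, D v -> q p.1 v = ip mu p.2 v]].

Definition markovian_extension (R : realType) (X : countType) (mu : X -> R)
    (S T : set ((X -> R) * (X -> R))) : Prop :=
  [/\ self_adjoint mu T, S `<=` T &
      exists q D, dirichlet_form mu q D /\ form_operator mu q D = T].

Definition Cc (R : realType) (X : countType) : set (X -> R) :=
  [set u | finite_set [set x | u x != 0]].
Arguments Cc : clear implicits.

Definition energy (R : realType) (X : countType) (G : weighted_graph R X)
    (f : X -> R) : \bar R :=
  ((2^-1)%:E * (\esum_(p in [set: X * X])
     (weight G p.1 p.2 * (f p.1 - f p.2) ^+ 2)%:E))%E.

(* Polarization; meaningful when f and g have finite energy. *)
Definition energy_form (R : realType) (X : countType) (G : weighted_graph R X)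
    (f g : X -> R) : R :=
  (fine (energy G (f \+ g)) - fine (energy G (f \- g))) / 4.

Definition energy_norm (R : realType) (X : countType) (G : weighted_graph R X)
    (f : X -> R) : \bar R :=
  sqrte (energy G f + l2norm (mass G) f ^+ 2)%E.

Definition form_domain (R : realType) (X : countType)
    (G : weighted_graph R X) : set (X -> R) :=
  [set f | [/\ L2 (mass G) f, (energy G f < +oo)%E &
    forall eps : R, 0 < eps ->
      exists2 g, Cc R X g & (energy_norm G (f \- g)%R < eps%:E)%E]].

Definition laplacian (R : realType) (X : countType)
    (G : weighted_graph R X) : set ((X -> R) * (X -> R)) :=
  form_operator (mass G) (energy_form G) (form_domain G).

(* The sum is finite on a locally finite graph. *)
Definition formal_laplacian (R : realType) (X : countType)
    (G : weighted_graph R X) (f : X -> R) : X -> R :=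
  fun x => (mass G x)^-1 * rsum (fun y => weight G x y * (f x - f y)).

Definition minimal_laplacian (R : realType) (X : countType)
    (G : weighted_graph R X) : set ((X -> R) * (X -> R)) :=
  [set p | Cc R X p.1 /\ p.2 = formal_laplacian G p.1].

(* Main.v *)
(** Completeness and local finiteness make all balls of [d] finite (otherwise
there is an infinite path of finite length), so [x |-> 1 - d(o, x) / n],
suitably truncated, gives finitely supported cutoff functions [eta], equal to
[1] on a given finite set, whose gradient is as small as desired because [d] is
intrinsic. Testing [Delta u] against [eta ^ 2 u] bounds the energy of [eta u]
by a constant that does not depend on [eta]. Hence [u] and [Delta u] in L2
imply finite energy; moreover [eta v] tends to [v] in energy norm, so that
every L2 function of finite energy is in the form domain and Green's formula
[E(u, v) = <Delta u, v>] holds there. Therefore the maximal operator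
[u |-> Delta u], which is the adjoint of [L_c], is symmetric and nonnegative;
so it is self-adjoint and equal to [L], and [(1 + Delta) Cc] is dense, which
makes it the closure of [L_c]. Any self-adjoint extension of [L_c] is contained
in the adjoint of [L_c], hence equal to it. *)

Require Import Defs.
From mathcomp Require Import all_boot all_order all_algebra.
From mathcomp Require Import all_classical all_reals all_analysis.
From mathcomp Require Import finmap ring lra.

Set Implicit Arguments.
Unset Strict Implicit.
Unset Printing Implicit Defensive.
Import Order.TTheory GRing.Theory Num.Theory.
Import numFieldNormedType.Exports.
Local Open Scope classical_set_scope.
Local Open Scope ring_scope.

(** * Absolutely summable real families *)

Section Sums.
Variables (R : realType) (T : choiceType).
Implicit Types (f g : T -> R) (s t : seq T).

Definition summ f : Prop := (\esum_(x in [set: T]) (`|f x|)%:E < +oo)%E.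

Lemma esum_ge_sum f s : (forall x, 0 <= f x) -> uniq s ->
  ((\sum_(x <- s) f x)%:E <= \esum_(x in [set: T]) (f x)%:E)%E.
Proof.
move=> f0 us; apply: esum_ge; exists [set` s]; first by split.
by rewrite -sumEFin fsbig_seq.
Qed.

Lemma esum_le_bound f M : (forall x, 0 <= f x) ->
  (forall s, uniq s -> \sum_(x <- s) f x <= M) ->
  (\esum_(x in [set: T]) (f x)%:E <= M%:E)%E.
Proof.
move=> f0 fM; apply: ge_ereal_sup => /= _ [A [finA _] <-].
by rewrite fsbig_finite// sumEFin lee_fin; apply: fM; exact: fset_uniq.
Qed.

Lemma esum_fin_num f : (forall x, 0 <= f x) ->
  (\esum_(x in [set: T]) (f x)%:E < +oo)%E ->
  (\esum_(x in [set: T]) (f x)%:E) \is a fin_num.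
Proof.
by move=> f0 fo; rewrite ge0_fin_numE// esum_ge0// => x _; rewrite lee_fin.
Qed.

Lemma summ_ge0E f : (forall x, 0 <= f x) ->
  summ f <-> (\esum_(x in [set: T]) (f x)%:E < +oo)%E.
Proof.
by move=> f0; rewrite /summ; under eq_esum => x _ do rewrite ger0_norm//.
Qed.

Lemma rsum_ge0E f : (forall x, 0 <= f x) ->
  rsum f = fine (\esum_(x in [set: T]) (f x)%:E).
Proof.
move=> f0; rewrite /rsum [X in _ - fine X]esum1 ?subr0 => [|x _].
  by congr fine; apply: eq_esum => x _; rewrite max_l.
by rewrite max_r// oppr_le0.
Qed.

Lemma esum_rsum f : (forall x, 0 <= f x) -> summ f ->
  (\esum_(x in [set: T]) (f x)%:E)%E = (rsum f)%:E.
Proof.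
by move=> f0 /summ_ge0E sf; rewrite rsum_ge0E// fineK// esum_fin_num// sf.
Qed.

Lemma le_summ f g : (forall x, `|f x| <= g x) -> summ g -> summ f.
Proof.
move=> fg; apply: le_lt_trans; apply: le_esum => x _.
by rewrite lee_fin (le_trans (fg x))// ler_norm.
Qed.

Lemma summ_norm f : summ f -> summ (fun x => `|f x|).
Proof. by move=> sf; rewrite /summ; under eq_esum do rewrite normr_id. Qed.

(** The sum of a nonnegative family is the supremum of its finite partial sums, so bounding these
    yields summability and the estimate at once. *)
Lemma rsum_le_bound f M : (forall x, 0 <= f x) ->
  (forall s, uniq s -> \sum_(x <- s) f x <= M) -> summ f /\ rsum f <= M.
Proof.
move=> f0 fM; have le := esum_le_bound f0 fM.
have sf : summ f by apply/summ_ge0E => //; apply: le_lt_trans le _; rewrite ltry.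
by split=> //; rewrite -lee_fin -esum_rsum.
Qed.

Lemma sum_le_rsum f s : (forall x, 0 <= f x) -> summ f -> uniq s ->
  \sum_(x <- s) f x <= rsum f.
Proof. by move=> f0 sf us; rewrite -lee_fin -esum_rsum// esum_ge_sum. Qed.

Lemma rsum_ge0 f : (forall x, 0 <= f x) -> 0 <= rsum f.
Proof.
by move=> f0; rewrite rsum_ge0E// fine_ge0// esum_ge0// => x _; rewrite lee_fin.
Qed.

Lemma summD f g : summ f -> summ g -> summ (fun x => f x + g x).
Proof.
move=> sf sg; apply: (@le_lt_trans _ _
  (\esum_(x in [set: T]) ((`|f x|)%:E + (`|g x|)%:E))%E).
  by apply: le_esum => x _; rewrite -EFinD lee_fin ler_normD.
rewrite esumD; [|by move=> x _; rewrite lee_fin..].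
by rewrite lte_add_pinfty.
Qed.

Lemma summZ a f : summ f -> summ (fun x => a * f x).
Proof.
move=> sf; apply: (@le_summ _ (fun x => `|a| * `|f x|)) => [x|].
  by rewrite normrM.
apply: (proj1 (@rsum_le_bound _ (`|a| * rsum (fun x => `|f x|)) _ _)) => [x|s us].
  by rewrite mulr_ge0.
rewrite -mulr_sumr ler_wpM2l// sum_le_rsum//.
exact: summ_norm.
Qed.

Lemma summN f : summ f -> summ (fun x => - f x).
Proof. by rewrite /summ; under [X in _ -> (X < _)%E]eq_esum do rewrite normrN. Qed.

Lemma summB f g : summ f -> summ g -> summ (fun x => f x - g x).
Proof. by move=> sf /summN; exact: summD. Qed.

Lemma summ_max f : summ f -> summ (fun x => Num.max (f x) 0).
Proof.
move=> /summ_norm; apply: le_summ => x; case: (leP (f x) 0) => f0.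
  by rewrite normr0.
by rewrite lexx.
Qed.

Lemma ge0_rsumD f g : (forall x, 0 <= f x) -> (forall x, 0 <= g x) ->
  summ f -> summ g -> rsum (fun x => f x + g x) = rsum f + rsum g.
Proof.
move=> f0 g0 sf sg; have fg0 x : 0 <= f x + g x by rewrite addr_ge0.
apply: EFin_inj; rewrite [RHS]EFinD -(esum_rsum f0 sf) -(esum_rsum g0 sg).
rewrite -(esum_rsum fg0 (summD sf sg)) -esumD; last 2 first.
- by move=> x _; rewrite lee_fin.
- by move=> x _; rewrite lee_fin.
by apply: eq_esum => x _; rewrite EFinD.
Qed.

Lemma rsum_split f : rsum f =
  rsum (fun x => Num.max (f x) 0) - rsum (fun x => Num.max (- f x) 0).
Proof. by rewrite [LHS]/rsum !rsum_ge0E// => x; rewrite le_max lexx orbT. Qed.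

(** With positive and negative parts [f+] and [f-], one has [f+ + h = g + f-], and nonnegative
    families add. This carries linearity over from nonnegative to signed families. *)
Lemma rsum_sub f g h : (forall x, 0 <= g x) -> (forall x, 0 <= h x) ->
  summ g -> summ h -> (forall x, f x = g x - h x) -> rsum f = rsum g - rsum h.
Proof.
move=> g0 h0 sg sh fE; have -> : f = (fun x => g x - h x) by exact/funext.
set k := fun x => _; have sk : summ k by exact: summB.
have max0 (a : R) : 0 <= Num.max a 0 by rewrite le_max lexx orbT.
rewrite rsum_split; apply/eqP; rewrite subr_eq -addrAC eq_sym subr_eq; apply/eqP.
rewrite -!ge0_rsumD//; try exact: summ_max; last by apply: summ_max; exact: summN.
congr rsum; apply/funext => x; rewrite /k.
by case: (leP (g x - h x) 0); case: (leP (- (g x - h x)) 0); lra.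
Qed.

Lemma max_sub (a : R) : a = Num.max a 0 - Num.max (- a) 0.
Proof. by case: (leP a 0); case: (leP (- a) 0); lra. Qed.

Lemma rsumD f g : summ f -> summ g ->
  rsum (fun x => f x + g x) = rsum f + rsum g.
Proof.
move=> sf sg.
have max0 (a : R) : 0 <= Num.max a 0 by rewrite le_max lexx orbT.
have := summ_max (summN sg); have := summ_max sg.
have := summ_max (summN sf); have := summ_max sf => ? ? ? ?.
rewrite (@rsum_sub _ (fun x => Num.max (f x) 0 + Num.max (g x) 0)
  (fun x => Num.max (- f x) 0 + Num.max (- g x) 0)).
- by rewrite !ge0_rsumD// (rsum_split f) (rsum_split g); lra.
- by move=> x; rewrite addr_ge0.
- by move=> x; rewrite addr_ge0.
- exact: summD.
- exact: summD.
- by move=> x; rewrite {1}(max_sub (f x)) {1}(max_sub (g x)); lra.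
Qed.

Lemma rsumN f : rsum (fun x => - f x) = - rsum f.
Proof.
rewrite (rsum_split f) opprB rsum_split.
by under [X in _ - rsum X]eq_fun do rewrite opprK.
Qed.

Lemma rsumB f g : summ f -> summ g ->
  rsum (fun x => f x - g x) = rsum f - rsum g.
Proof. by move=> sf sg; rewrite rsumD ?rsumN//; exact: summN. Qed.

Lemma ler_rsum f g : summ f -> summ g -> (forall x, f x <= g x) ->
  rsum f <= rsum g.
Proof.
by move=> sf sg fg; rewrite -subr_ge0 -rsumB// rsum_ge0// => x; rewrite subr_ge0.
Qed.

Lemma rsum_fin f s : uniq s -> (forall x, x \notin s -> f x = 0) ->
  summ f /\ rsum f = \sum_(x <- s) f x.
Proof.
move=> us f0.
have ge0 g : (forall x, 0 <= g x) -> (forall x, x \notin s -> g x = 0) ->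
    summ g /\ rsum g = \sum_(x <- s) g x.
  move=> g0 gs; have [sg le] : summ g /\ rsum g <= \sum_(x <- s) g x.
    apply: rsum_le_bound => // t ut.
    (* A sum over [t] sees only the entries lying in [s]; the other terms of the sum over [s] are
       nonnegative. *)
    rewrite (bigID (mem s))/= [X in _ + X]big1 ?addr0 => [|x xs]; last exact: gs.
    rewrite -big_filter [leRHS](bigID (mem t))/= -[X in _ <= X + _]big_filter.
    rewrite (perm_big [seq x <- s | x \in t]) ?lerDl ?sumr_ge0//=.
    apply: uniq_perm; rewrite ?filter_uniq// => x.
    by rewrite !mem_filter andbC.
  by split=> //; apply/eqP; rewrite eq_le le sum_le_rsum.
have max0 (a : R) : 0 <= Num.max a 0 by rewrite le_max lexx orbT.
split.
  have [//|x xs|+ _] := @ge0 (fun x => `|f x|); first by rewrite f0 ?normr0.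
  by apply: le_summ.
rewrite rsum_split; have [//|x xs|_ ->] := @ge0 (fun x => Num.max (f x) 0).
  by rewrite f0// maxxx.
have [//|x xs|_ ->] := @ge0 (fun x => Num.max (- f x) 0).
  by rewrite f0// oppr0 maxxx.
by rewrite -sumrB; apply: eq_bigr => x _; rewrite -max_sub.
Qed.

Lemma rsumZ a f : summ f -> rsum (fun x => a * f x) = a * rsum f.
Proof.
have le (b : R) g : 0 <= b -> (forall x, 0 <= g x) -> summ g ->
    rsum (fun x => b * g x) <= b * rsum g.
  move=> b0 g0 sg; apply: (proj2 (@rsum_le_bound _ _ _ _)) => [x|s us].
    by rewrite mulr_ge0.
  by rewrite -mulr_sumr ler_wpM2l// sum_le_rsum.
have pos (b : R) g : 0 < b -> (forall x, 0 <= g x) -> summ g ->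
    rsum (fun x => b * g x) = b * rsum g.
  move=> b0 g0 sg; have b0W := ltW b0; apply/eqP; rewrite eq_le le//=.
  have bg0 x : 0 <= b * g x by rewrite mulr_ge0// ltW.
  have bV : 0 <= b^-1 by rewrite invr_ge0 ltW.
  (* The reverse inequality is the same bound for the factor [b^-1] and the family [b * g]. *)
  rewrite -ler_pdivlMl//; have := le _ _ bV bg0 (summZ b sg).
  by under [X in rsum X <= _]eq_fun do rewrite mulKf ?gt_eqF//.
have max0 (b : R) : 0 <= Num.max b 0 by rewrite le_max lexx orbT.
have gen (b : R) : 0 < b -> summ f -> rsum (fun x => b * f x) = b * rsum f.
  move=> b0 sf; have sp := summ_max sf; have sn := summ_max (summN sf).
  rewrite (@rsum_sub _ (fun x => b * Num.max (f x) 0)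
    (fun x => b * Num.max (- f x) 0)).
  - by rewrite !pos// -mulrBr -rsum_split.
  - by move=> x; exact: mulr_ge0 (ltW b0) (max0 _).
  - by move=> x; exact: mulr_ge0 (ltW b0) (max0 _).
  - exact: summZ.
  - exact: summZ.
  - by move=> x; rewrite -mulrBr -max_sub.
move=> sf; case: (ltgtP 0 a) => [a0|a0|<-]; first exact: gen.
  rewrite -[a]opprK mulNr -gen ?oppr_gt0// -rsumN.
  by congr rsum; apply/funext => x; rewrite mulNr.
rewrite mul0r; have [//|x _|_ ->] := @rsum_fin (fun x => 0 * f x) [::].
  by rewrite mul0r.
by rewrite big_nil.
Qed.

(** Some finite partial sum exceeds [rsum f - e]; what [f] dominates off that finite set fits into
    the remaining [e]. This plays the role of dominated convergence. *)
Lemma rsum_tail f e : (forall x, 0 <= f x) -> summ f -> 0 < e ->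
  exists s, forall g, (forall x, 0 <= g x <= f x) ->
    (forall x, x \in s -> g x = 0) -> rsum g <= e.
Proof.
move=> f0 sf e0.
have [s us fs] : exists2 s, uniq s & rsum f - e < \sum_(x <- s) f x.
  apply: contrapT => nex.
  have [_] : summ f /\ rsum f <= rsum f - e.
    apply: rsum_le_bound => // s us; rewrite leNgt; apply/negP => lt.
    by apply: nex; exists s.
  by lra.
exists s => g gf gs; apply: (proj2 (@rsum_le_bound _ _ _ _)) => [x|t ut].
  by case/andP: (gf x).
rewrite (bigID (mem s))/= big1 ?add0r => [|x xs]; last exact: gs.
rewrite -big_filter; set r := [seq _ <- _ | _].
have : \sum_(x <- r ++ s) f x <= rsum f.
  apply: sum_le_rsum => //; rewrite cat_uniq us filter_uniq//= andbT.
  apply/hasPn => x xs; rewrite /r mem_filter/= .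
  by rewrite xs.
rewrite big_cat/=; have : \sum_(x <- r) g x <= \sum_(x <- r) f x.
  by apply: ler_sum => x _; case/andP: (gf x).
by lra.
Qed.

End Sums.

(** A finite set of pairs lies in the product of its projections, which can be summed row by row:
    the half of Tonelli's theorem that turns bounds at vertices into bounds over edges. *)
Lemma rsum_prod_le (R : realType) (T U : choiceType) (f : T * U -> R)
    (h : T -> R) : (forall p, 0 <= f p) -> (forall x, 0 <= h x) -> summ h ->
  (forall x s, uniq s -> \sum_(y <- s) f (x, y) <= h x) ->
  summ f /\ rsum f <= rsum h.
Proof.
move=> f0 h0 sh fh; apply: rsum_le_bound => // s us.
pose s1 := undup (map fst s); pose s2 := undup (map snd s).
apply: (@le_trans _ _ (\sum_(x <- s1) h x)); last first.
  by rewrite sum_le_rsum ?undup_uniq.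
apply: (@le_trans _ _ (\sum_(x <- s1) \sum_(y <- s2) f (x, y))); last first.
  by apply: ler_sum => x _; rewrite fh ?undup_uniq.
have us12 : uniq [seq (x, y) | x <- s1, y <- s2].
  by rewrite allpairs_uniq ?undup_uniq// => -[? ?] [? ?].
have -> : \sum_(x <- s1) \sum_(y <- s2) f (x, y) =
    \sum_(p <- [seq (x, y) | x <- s1, y <- s2]) f p by rewrite big_allpairs.
rewrite [leRHS](bigID (mem s))/= -[X in _ <= X + _]big_filter.
rewrite [leLHS](perm_big
  [seq p <- [seq (x, y) | x <- s1, y <- s2] | p \in s]) ?lerDl ?sumr_ge0//=.
apply: uniq_perm; rewrite ?filter_uniq// => -[x y].
rewrite mem_filter; case: (boolP ((x, y) \in s)) => //= ps; apply/esym.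
apply/allpairsP; exists (x, y); split => //; rewrite mem_undup; apply/mapP.
  by exists (x, y).
by exists (x, y).
Qed.

(** * Weighted l2 spaces *)

Section WeightedL2.
Variables (R : realType) (T : countType) (m : T -> R).
Hypothesis m_ge0 : forall x, 0 <= m x.
Implicit Types (u v w : T -> R).

(** The weight is arbitrary and may vanish, so that one theory serves both functions on vertices and
    gradients on ordered pairs of vertices. *)
Definition sq_summ u : Prop := summ (fun x => u x ^+ 2 * m x).

Let sqm_ge0 u x : 0 <= u x ^+ 2 * m x.
Proof. by rewrite mulr_ge0// sqr_ge0. Qed.

Lemma summ_ip u v : sq_summ u -> sq_summ v -> summ (fun x => u x * v x * m x).
Proof.
move=> su sv; apply: le_summ (summD su sv) => x /=.
rewrite -mulrDl normrM (ger0_norm (m_ge0 x)) ler_wpM2r// ler_norml.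
by apply/andP; split; nra.
Qed.

Lemma ipE u : ip m u u = rsum (fun x => u x ^+ 2 * m x).
Proof. by []. Qed.

Lemma sq_summ_le u v : (forall x, u x ^+ 2 <= v x ^+ 2) -> sq_summ v ->
  sq_summ u.
Proof.
move=> uv; apply: le_summ => x; rewrite ger0_norm//.
by rewrite ler_wpM2r// uv.
Qed.

Lemma ip_le u v : (forall x, u x ^+ 2 <= v x ^+ 2) -> sq_summ v ->
  ip m u u <= ip m v v.
Proof.
move=> uv sv; rewrite !ipE; apply: ler_rsum => //.
  exact: sq_summ_le sv.
by move=> x; rewrite ler_wpM2r// uv.
Qed.

Lemma sq_summZ a u : sq_summ u -> sq_summ (a \*o u).
Proof.
move=> /(summZ (a ^+ 2)); rewrite /sq_summ.
by under [X in _ -> summ X]eq_fun do rewrite /= exprMn -mulrA.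
Qed.

Lemma sq_summD u v : sq_summ u -> sq_summ v -> sq_summ (u \+ v).
Proof.
move=> su sv; apply: le_summ (summD (summZ 2 su) (summZ 2 sv)) => x /=.
rewrite ger0_norm; last exact: (sqm_ge0 (u \+ v) x).
by rewrite !mulrA -mulrDl ler_wpM2r//; have := sqr_ge0 (u x - v x); lra.
Qed.

Lemma sq_summB u v : sq_summ u -> sq_summ v -> sq_summ (u \- v).
Proof.
move=> su /(sq_summZ (-1)) /(sq_summD su).
by congr sq_summ; apply/funext => x /=; rewrite mulN1r.
Qed.

Lemma sq_summ0 : sq_summ (fun=> 0).
Proof.
rewrite /sq_summ; have [//|x _|//] := @rsum_fin R T (fun x => 0 ^+ 2 * m x) [::].
by rewrite expr0n/= mul0r.
Qed.

Lemma ipC u v : ip m u v = ip m v u.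
Proof. by congr rsum; apply/funext => x; rewrite [u x * _]mulrC. Qed.

Lemma ipDl u v w : sq_summ u -> sq_summ v -> sq_summ w ->
  ip m (u \+ v) w = ip m u w + ip m v w.
Proof.
move=> su sv sw; rewrite -rsumD; [|exact: summ_ip..].
by congr rsum; apply/funext => x /=; rewrite !mulrDl.
Qed.

Lemma ipZl a u w : sq_summ u -> sq_summ w ->
  ip m (a \*o u) w = a * ip m u w.
Proof.
move=> su sw; rewrite -rsumZ; last exact: summ_ip.
by congr rsum; apply/funext => x /=; rewrite !mulrA.
Qed.

Lemma ipBl u v w : sq_summ u -> sq_summ v -> sq_summ w ->
  ip m (u \- v) w = ip m u w - ip m v w.
Proof.
move=> su sv sw; rewrite -rsumB; [|exact: summ_ip..].
by congr rsum; apply/funext => x /=; rewrite !mulrBl.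
Qed.

Lemma ipDr u v w : sq_summ u -> sq_summ v -> sq_summ w ->
  ip m w (u \+ v) = ip m w u + ip m w v.
Proof. by move=> su sv sw; rewrite ipC ipDl// !(ipC w). Qed.

Lemma ipZr a u w : sq_summ u -> sq_summ w ->
  ip m w (a \*o u) = a * ip m w u.
Proof. by move=> su sw; rewrite ipC ipZl// ipC. Qed.

Lemma ipBr u v w : sq_summ u -> sq_summ v -> sq_summ w ->
  ip m w (u \- v) = ip m w u - ip m w v.
Proof. by move=> su sv sw; rewrite ipC ipBl// !(ipC w). Qed.

Lemma ip_ge0 u : 0 <= ip m u u.
Proof. by rewrite ipE; apply: rsum_ge0 => x; exact: sqm_ge0. Qed.

Lemma ip_sqrD u v : sq_summ u -> sq_summ v ->
  ip m (u \+ v) (u \+ v) = ip m u u + 2 * ip m u v + ip m v v.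
Proof.
move=> su sv; have suv := sq_summD su sv.
by rewrite ipDl// !ipDr// (ipC v u); ring.
Qed.

Lemma ip_sqrB u v : sq_summ u -> sq_summ v ->
  ip m (u \- v) (u \- v) = ip m u u - 2 * ip m u v + ip m v v.
Proof.
move=> su sv; have suv := sq_summB su sv.
by rewrite ipBl// !ipBr// (ipC v u); ring.
Qed.

Lemma ip_sqrZ a u : sq_summ u -> ip m (a \*o u) (a \*o u) = a ^+ 2 * ip m u u.
Proof.
by move=> su; have sau := sq_summZ a su; rewrite ipZl// ipZr// mulrA -expr2.
Qed.

Lemma ip_parallelogram u v : sq_summ u -> sq_summ v ->
  ip m (u \- v) (u \- v) + ip m (u \+ v) (u \+ v) = 2 * (ip m u u + ip m v v).
Proof. by move=> su sv; rewrite ip_sqrD// ip_sqrB//; ring. Qed.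

(** Expand the nonnegative square norm of [u - t v]. *)
Lemma ip_young t u v : sq_summ u -> sq_summ v ->
  2 * t * ip m u v <= ip m u u + t ^+ 2 * ip m v v.
Proof.
move=> su sv; have stv := sq_summZ t sv.
have := ip_ge0 (u \- t \*o v); rewrite ip_sqrB// ip_sqrZ// ipZr//.
by lra.
Qed.

Lemma ip_CauchySchwarz u v : sq_summ u -> sq_summ v ->
  ip m u v ^+ 2 <= ip m u u * ip m v v.
Proof.
move=> su sv; have uu := ip_ge0 u; have vv := ip_ge0 v.
have yg t := ip_young t su sv.
move: (ip m u v) (ip m u u) (ip m v v) uu vv yg => b a c a0 c0 yg.
case: (ltgtP 0 c) c0 => // [cp|c00] _; last first.
  rewrite -c00 mulr0; have [->|b0] := eqVneq b 0; first by rewrite expr0n.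
  (* For [c = 0] and [b] nonzero this parameter turns Young's inequality into [a + 1 <= a]. *)
  have := yg ((a + 1) / (2 * b)); rewrite -c00 mulr0 addr0.
  by have -> : 2 * ((a + 1) / (2 * b)) * b = a + 1 by [field]; lra.
(* The value [t = b / c] maximizes [2 t b - t^2 c]. *)
have := yg (b / c); have -> : (b / c) ^+ 2 * c = b ^+ 2 / c.
  by field; rewrite gt_eqF.
have -> : 2 * (b / c) * b = 2 * (b ^+ 2 / c) by field; rewrite gt_eqF.
by rewrite -ler_pdivrMr//; lra.
Qed.

(** By Cauchy-Schwarz, pairing with [u] is continuous; the [+ 1] in the choice of [d] covers
    [ip m u u = 0]. *)
Lemma ip_small u e : sq_summ u -> 0 < e -> exists2 d, 0 < d &
  forall v, sq_summ v -> ip m v v < d -> `|ip m u v| < e.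
Proof.
move=> su e0; have uu := ip_ge0 u.
have u1 : 0 < ip m u u + 1 by lra.
exists (e ^+ 2 / (ip m u u + 1)); first by rewrite divr_gt0// exprn_gt0.
move=> v sv vd; have cs := ip_CauchySchwarz su sv; have vv := ip_ge0 v.
move: vd; rewrite ltr_pdivlMr// => vd.
have be : ip m u v ^+ 2 < e ^+ 2 by apply: le_lt_trans cs _; nra.
by rewrite ltr_norml; apply/andP; split; nra.
Qed.

(** Finite partial sums are continuous in the pointwise values, so the bound survives the limit:
    Fatou's lemma. *)
Lemma rsum_fatou (u_ : nat -> T -> R) u c N :
  (forall x, u_ n x @[n --> \oo] --> u x) ->
  (forall n, (N <= n)%N -> sq_summ (u_ n) /\ ip m (u_ n) (u_ n) <= c) ->
  sq_summ u /\ ip m u u <= c.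
Proof.
move=> uu_ uc; apply: rsum_le_bound => [x|s us]; first exact: sqm_ge0.
have cvs : (\sum_(x <- s) u_ n x * u_ n x * m x) @[n --> \oo] -->
    \sum_(x <- s) u x * u x * m x.
  elim: s {us} => [|x s IH].
    rewrite big_nil; under eq_fun do rewrite big_nil.
    exact: cvg_cst.
  rewrite big_cons; under eq_fun do rewrite big_cons.
  by apply: cvgD => //; apply: cvgM; [exact: cvgM|exact: cvg_cst].
rewrite -(cvg_lim _ cvs)//; apply: limr_le; first by apply/cvg_ex; eexists; exact: cvs.
near=> n; have [|sn cn] := uc n; first by near: n; exact: nbhs_infty_ge.
apply: le_trans cn; apply: sum_le_rsum => // x; exact: sqm_ge0.
Unshelve. all: by end_near.
Qed.

Definition ip_cauchy (u_ : nat -> T -> R) := forall e, 0 < e ->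
  exists N, forall i j, (N <= i)%N -> (N <= j)%N ->
    ip m (u_ i \- u_ j) (u_ i \- u_ j) < e.

(** Fatou's lemma is applied to [u_ n - u_ j] with [n] fixed and [j] growing. The pointwise limit is
    assumed because a weight that may vanish does not control point values. *)
Lemma ip_cauchy_lim (u_ : nat -> T -> R) u : (forall n, sq_summ (u_ n)) ->
  ip_cauchy u_ -> (forall x, u_ n x @[n --> \oo] --> u x) ->
  sq_summ u /\ forall e, 0 < e -> exists N, forall n, (N <= n)%N ->
    ip m (u_ n \- u) (u_ n \- u) <= e.
Proof.
move=> su_ cu uu.
have lim e : 0 < e -> exists N, forall n, (N <= n)%N ->
    sq_summ (u_ n \- u) /\ ip m (u_ n \- u) (u_ n \- u) <= e.
  move=> /cu [N HN]; exists N => n Nn.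
  apply: (@rsum_fatou (fun j => u_ n \- u_ j) _ e N).
    by move=> x; apply: cvgB => //; exact: cvg_cst.
  by move=> j Nj; split; [exact: sq_summB|apply: ltW; exact: HN].
split.
  have [N /(_ _ (leqnn N)) [sN _]] := lim 1 ltr01.
  have := sq_summB (su_ N) sN; congr sq_summ.
  by apply/funext => x /=; rewrite subKr.
by move=> e /lim [N HN]; exists N => n /HN [].
Qed.

End WeightedL2.

(** * Completeness and dense subspaces for a strictly positive weight *)

Section PositiveWeight.
Variables (R : realType) (T : countType) (m : T -> R).
Hypothesis m_gt0 : forall x, 0 < m x.
Implicit Types (u v w : T -> R).

Let m_ge0 x : 0 <= m x. Proof. exact: ltW. Qed.

Lemma ip_sq_ge u x : sq_summ m u -> u x ^+ 2 * m x <= ip m u u.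
Proof.
move=> su; rewrite ipE.
have := @sum_le_rsum _ _ (fun x => u x ^+ 2 * m x) [:: x] _ su isT.
by rewrite big_seq1; apply => y; rewrite mulr_ge0// sqr_ge0.
Qed.

Lemma ip_eq0 u : sq_summ m u -> ip m u u <= 0 -> u = fun=> 0.
Proof.
move=> su u0; apply/funext => x; have := le_trans (ip_sq_ge x su) u0.
rewrite pmulr_lle0// => ux; apply/eqP.
by rewrite -sqrf_eq0 eq_le ux sqr_ge0.
Qed.

Lemma ip_cauchy_cvg (u_ : nat -> T -> R) : (forall n, sq_summ m (u_ n)) ->
  ip_cauchy m u_ -> exists u, forall x, u_ n x @[n --> \oo] --> u x.
Proof.
move=> su cu; exists (fun x => lim (u_ n x @[n --> \oo])) => x.
apply: (@cauchy_cvg R); apply: cauchy_exP => e e0.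
(* The square norm bounds the square of the value at [x] times [m x], whence this tolerance. *)
have [N HN] := cu (e ^+ 2 * m x) (mulr_gt0 (exprn_gt0 2 e0) (m_gt0 x)).
exists (u_ N x); exists N => // n /= Nn; rewrite /ball/=.
have : (u_ N x - u_ n x) ^+ 2 < e ^+ 2.
  rewrite -(ltr_pM2r (m_gt0 x)); apply: le_lt_trans (HN N n (leqnn N) Nn).
  by apply: (@ip_sq_ge (u_ N \- u_ n)); exact: sq_summB.
by rewrite ltr_norml => lt; apply/andP; split; nra.
Qed.

Lemma ip_complete (u_ : nat -> T -> R) : (forall n, sq_summ m (u_ n)) ->
  ip_cauchy m u_ -> exists u, [/\ forall x, u_ n x @[n --> \oo] --> u x,
    sq_summ m u & forall e, 0 < e -> exists N, forall n, (N <= n)%N ->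
    ip m (u_ n \- u) (u_ n \- u) <= e].
Proof.
move=> su cu; have [u uu] := ip_cauchy_cvg su cu.
by have [? ?] := ip_cauchy_lim m_ge0 su cu uu; exists u.
Qed.

Lemma inv_small (e : R) : 0 < e -> exists N : nat, forall n, (N <= n)%N ->
  n.+1%:R^-1 < e.
Proof.
move=> e0; have [N _ HN] := near_infty_natSinv_lt (PosNum e0).
by exists N => n Nn; exact: HN.
Qed.

(* A minimizing sequence of the distance from [f] to [D] is Cauchy; the
   difference of [f] and its limit is orthogonal to [D]. *)
Lemma subspace_dense (D : set (T -> R)) : Defs.subspace D ->
  D `<=` sq_summ m ->
  (forall f, sq_summ m f -> (forall g, D g -> ip m f g = 0) -> f = fun=> 0) ->
  forall f e, sq_summ m f -> 0 < e ->
  exists2 g, D g & ip m (f \- g) (f \- g) < e.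
Proof.
move=> [D0 DD DZ] sD Dperp f e sf e0.
pose F g := ip m (f \- g) (f \- g).
pose E := [set F g | g in D]; pose c := inf E.
have cF g : D g -> c <= F g.
  by move=> Dg; apply: ge_inf; [exists 0 => _ [h _ <-]; exact: ip_ge0|exists g].
have ninv0 n : 0 < n.+1%:R^-1 :> R by rewrite invr_gt0 ltr0n.
have /choice [g_ Hg] n : exists g, D g /\ F g < c + n.+1%:R^-1.
  have E0 : E !=set0 by exists (F (fun=> 0)); exists (fun=> 0).
  have [|_ [g Dg <-] gc] := @inf_lt _ E (c + n.+1%:R^-1) E0.
    by rewrite ltrDl.
  by exists g.
have sg n : sq_summ m (g_ n) by apply: sD; case: (Hg n).
have sfg n : sq_summ m (f \- g_ n) by exact: sq_summB.
have gij i j : ip m (g_ i \- g_ j) (g_ i \- g_ j) <=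
    2 * (i.+1%:R^-1 + j.+1%:R^-1).
  have [Di Fi] := Hg i; have [Dj Fj] := Hg j.
  have pl := ip_parallelogram m_ge0 (sfg i) (sfg j).
  have dE : ip m (g_ i \- g_ j) (g_ i \- g_ j) =
      ip m ((f \- g_ i) \- (f \- g_ j)) ((f \- g_ i) \- (f \- g_ j)).
    by congr rsum; apply/funext => x /=; ring.
  (* The sum of the two differences is twice the difference of [f] and the midpoint of [g_ i] and
     [g_ j]. The midpoint lies in [D], so this square norm is at least [4 c]. *)
  have mE : ip m ((f \- g_ i) \+ (f \- g_ j)) ((f \- g_ i) \+ (f \- g_ j)) =
      4 * F (2^-1 \*o (g_ i \+ g_ j)).
    have -> : 4 = 2 ^+ 2 :> R by rewrite -natrX.
    rewrite -ip_sqrZ//; last first.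
      by apply: sq_summB => //; apply: sq_summZ => //; exact: sq_summD.
    by congr rsum; apply/funext => x /=; field.
  have := cF _ (DZ 2^-1 _ (DD _ _ Di Dj)).
  rewrite dE; rewrite mE in pl; rewrite /F in Fi Fj.
  move: (i.+1%:R^-1) (j.+1%:R^-1) Fi Fj pl => a b.
  by lra.
have cg : ip_cauchy m g_.
  move=> d d0; have d4 : 0 < d / 4 by lra.
  have [N HN] := inv_small d4; exists N => i j Ni Nj.
  apply: le_lt_trans (gij i j) _; have := HN i Ni; have := HN j Nj.
  move: (i.+1%:R^-1) (j.+1%:R^-1) => a b; lra.
have [h [_ sh gh]] := ip_complete sg cg.
have sfh : sq_summ m (f \- h) by exact: sq_summB.
have sgh n : sq_summ m (g_ n \- h) by exact: sq_summB.
have fh : f \- h = fun=> 0.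
  apply: Dperp => // k Dk; have sk := sD _ Dk.
  have kk := ip_ge0 m_ge0 k.
  (* The limit [h] need not lie in [D], so minimality is tested at [g_ n + t k]. If the claim
     failed, the excess of [F (g_ n)] over [c] and the square norm of [g_ n - h] could both be kept
     within the gap [A - B], which is contradictory. *)
  have key t : t * ip m (f \- h) k <= t ^+ 2 * ip m k k.
    rewrite leNgt; apply/negP; set B := _ * _; set A := _ * _ => BA.
    have AB : 0 < A - B by rewrite subr_gt0.
    have [N1 HN1] := inv_small AB; have [N2 HN2] := gh _ AB.
    pose n := maxn N1 N2; have := HN1 n (leq_maxl _ _).
    have := HN2 n (leq_maxr _ _); have [Dn Fn] := Hg n.
    have y1 := ip_young m_ge0 t (sgh n) sk.
    have := cF _ (DD _ _ Dn (DZ t _ Dk)).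
    have -> : F (g_ n \+ t \*o k) =
        ip m ((f \- g_ n) \- t \*o k) ((f \- g_ n) \- t \*o k).
      by congr rsum; apply/funext => x /=; ring.
    have stk := sq_summZ t sk.
    rewrite ip_sqrB// ip_sqrZ// ipZr//; rewrite /F in Fn.
    have hE : ip m (f \- h) k = ip m (f \- g_ n) k + ip m (g_ n \- h) k.
      rewrite -ipDl//; congr rsum; apply/funext => x /=; ring.
    move: Fn AB y1; rewrite /A /B hE; clear.
    by move: (n.+1%:R^-1) c => a d; lra.
  have k1 : 0 < ip m k k + 1 by lra.
  (* With [b] the pairing and [d] the square norm of [k], this [t] gives [b^2 (d + 1) <= b^2 d],
     hence [b = 0]. *)
  have := key (ip m (f \- h) k / (ip m k k + 1)).
  move: (ip m (f \- h) k) (ip m k k) kk k1 => b d d0 d1.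
  have -> : b / (d + 1) * b = b ^+ 2 * (d + 1) / (d + 1) ^+ 2.
    by field; rewrite gt_eqF.
  have -> : (b / (d + 1)) ^+ 2 * d = b ^+ 2 * d / (d + 1) ^+ 2.
    by field; rewrite gt_eqF.
  rewrite ler_pM2r ?invr_gt0 ?exprn_gt0// => bd.
  by apply/eqP; rewrite -sqrf_eq0 eq_le sqr_ge0 andbT; lra.
have e2 : 0 < e / 2 by lra.
have [N /(_ _ (leqnn N)) HN] := gh _ e2.
exists (g_ N); first by case: (Hg N).
apply: le_lt_trans (_ : e / 2 < e); last by lra.
apply: le_trans HN; rewrite le_eqVlt; apply/orP; left; apply/eqP.
congr rsum; apply/funext => x /=.
by have := congr1 (@^~ x) fh => /= /eqP; rewrite subr_eq add0r => /eqP ->; ring.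
Qed.

End PositiveWeight.

(** * Path metrics and cutoff functions *)

Lemma clamp_lipschitz (R : realFieldType) (s t : R) :
  (Num.min 1 (Num.max 0 s) - Num.min 1 (Num.max 0 t)) ^+ 2 <= (s - t) ^+ 2.
Proof.
have clamp r : Num.min 1 (Num.max 0 r) =
    if r <= 0 then 0 else if 1 <= r then 1 else r :> R.
  have [r0|r0] := leP r 0; first by rewrite min_r ?ler01.
  by have [r1|r1] := leP 1 r.
rewrite !clamp -subr_ge0 subr_sqr.
have [s0|s0] := leP s 0; have [t0|t0] := leP t 0.
- by rewrite subrr subr0 addr0 -expr2 sqr_ge0.
- have [t1|t1] := leP 1 t; rewrite mulr_le0//; lra.
- have [s1|s1] := leP 1 s; rewrite mulr_ge0//; lra.
- have [s1|s1] := leP 1 s; have [t1|t1] := leP 1 t.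
  + by rewrite subrr subr0 addr0 -expr2 sqr_ge0.
  + by rewrite mulr_ge0//; lra.
  + by rewrite mulr_le0//; lra.
  + by rewrite subrr mul0r.
Qed.

Section PathMetric.
Variables (R : realType) (X : countType) (G : weighted_graph R X).
Variable sigma : X -> X -> R.
Hypothesis sigmaP : edge_length G sigma.

Local Notation adj := (Defs.adjacent (weight G)).
Local Notation d := (path_metric G sigma).
Local Notation len := (path_length sigma).

Lemma path_length_nil x : len x [::] = 0.
Proof. by rewrite /path_length big_nil. Qed.

Lemma path_length_cons x y p : len x (y :: p) = sigma x y + len y p.
Proof. by rewrite /path_length big_cons. Qed.

Lemma path_length_cat x p q : len x (p ++ q) = len x p + len (last x p) q.
Proof. by rewrite /path_length pairmap_cat big_cat. Qed.

Lemma path_length_ge0 x p : 0 <= len x p.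
Proof.
elim: p x => [|y p IH] x; first by rewrite path_length_nil.
by rewrite path_length_cons addr_ge0// (edge_length_ge0 sigmaP).
Qed.

Lemma adj_sym x y : adj x y = adj y x.
Proof. by rewrite /Defs.adjacent weight_sym. Qed.

Lemma path_rev x p : path adj x p -> exists q,
  [/\ path adj (last x p) q, last (last x p) q = x & len (last x p) q = len x p].
Proof.
elim: p x => [|y p IH] x /=; first by exists [::].
move=> /andP[xy /IH [q [pq lq eq]]]; exists (q ++ [:: x]).
rewrite cat_path pq lq/= adj_sym xy last_cat/=; split => //.
rewrite path_length_cat eq lq !path_length_cons path_length_nil.
by rewrite (edge_length_sym sigmaP) addrC addr0.
Qed.

(** Admitting the empty path, of length [0], absorbs the diagonal case of the definition, so later
    arguments need neither the infimum nor the case [x = y]. *)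
Lemma path_metric_lt x y r : d x y < r <->
  exists p, [/\ path adj x p, last x p = y & len x p < r].
Proof.
rewrite /path_metric; case: eqVneq => [<-|xy].
  split=> [r0|[p [_ _]]]; first by exists [::]; rewrite path_length_nil.
  by apply: le_lt_trans; exact: path_length_ge0.
split=> [/inf_lt|[p [xp lp pr]]].
  have [p xp] := graph_connected G (elimN eqP xy).
  case; first by exists (len x p); exists p.
  by move=> _ [q [_ xq lq] <-] lt; exists q.
apply: le_lt_trans pr; apply: ge_inf.
  by exists 0 => _ [q _ <-]; exact: path_length_ge0.
exists p => //; split => //; apply: contra_neq xy => p0.
by rewrite -lp p0.
Qed.

Lemma path_metric_ge0 x y : 0 <= d x y.
Proof.
rewrite leNgt; apply/negP => /path_metric_lt [p [_ _]].
by rewrite ltNge path_length_ge0.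
Qed.

Lemma path_metric_le x p : path adj x p -> d x (last x p) <= len x p.
Proof.
move=> xp; apply/ler_addgt0Pr => e e0; apply/ltW/path_metric_lt.
by exists p; rewrite ltrDl.
Qed.

Lemma path_metric_sym_le x y : d x y <= d y x.
Proof.
apply/ler_addgt0Pr => e e0; have : d y x < d y x + e by rewrite ltrDl.
move=> /path_metric_lt [p [yp lp pe]]; apply/ltW/path_metric_lt.
by have := path_rev yp; rewrite lp => -[q [? ? eq]]; exists q; rewrite eq.
Qed.

Lemma path_metric_sym x y : d x y = d y x.
Proof. by apply/eqP; rewrite eq_le !path_metric_sym_le. Qed.

Lemma path_metric_triangle x y z : d x z <= d x y + d y z.
Proof.
apply/ler_addgt0Pr => e e0; have e2 : 0 < e / 2 by lra.
have : d x y < d x y + e / 2 by rewrite ltrDl.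
have : d y z < d y z + e / 2 by rewrite ltrDl.
move=> /path_metric_lt [q [yq lq qe]] /path_metric_lt [p [xp lp pe]].
apply/ltW/path_metric_lt; exists (p ++ q).
rewrite cat_path xp lp yq last_cat lp path_length_cat lp; split=> //; lra.
Qed.

Lemma path_metric_lipschitz o x y : (d o x - d o y) ^+ 2 <= d x y ^+ 2.
Proof.
have := path_metric_triangle o x y; have := path_metric_triangle o y x.
rewrite (path_metric_sym y x); have := path_metric_ge0 x y; nra.
Qed.

(** * Discreteness of the path metric and finiteness of balls *)

Hypothesis G_locally_finite : locally_finite G.

Lemma sigma_lower_bound x : exists2 r, 0 < r & forall y, adj x y -> r <= sigma x y.
Proof.
have /finite_seqP [s sE] := G_locally_finite x.
suff [r r0 rs] : exists2 r, 0 < r & forall y, y \in s -> adj x y -> r <= sigma x y.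
  exists r => // y xy; apply: rs => //.
  by have : [set` s] y by rewrite -sE.
elim: s {sE} => [|z s [r r0 IH]]; first by exists 1.
case: (boolP (adj x z)) => xz.
  exists (Num.min r (sigma x z)) => [|y].
    by rewrite lt_min r0; exact/(edge_length_gt0 sigmaP).
  rewrite inE => /orP[/eqP -> _|ys xy]; rewrite ge_min ?lexx ?orbT// IH//.
exists r => // y; rewrite inE => /orP[/eqP ->|]; last exact: IH.
by rewrite (negPf xz).
Qed.

(** A path leaving [x] starts with an edge at [x], and the finitely many such edges have lengths
    bounded below by a positive number. *)
Lemma path_metric_discrete x : exists2 r, 0 < r & forall y, d x y < r -> y = x.
Proof.
have [r r0 Hr] := sigma_lower_bound x; exists r => // y /path_metric_lt.
move=> [[|z p] [/= xp lp lr]]; first by [].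
case/andP: xp => xz _; move: lr; rewrite path_length_cons ltNge.
by rewrite (le_trans (Hr _ xz))// lerDl path_length_ge0.
Qed.

Let infinite_ball (p : X * R) := ~ finite_set [set y | d p.1 y < p.2].

(** A ball is covered by its center and the balls of remaining radius about the finitely many
    neighbors, so one of these must be infinite. *)
Lemma infinite_ball_step x r : infinite_ball (x, r) ->
  exists2 z, adj x z & infinite_ball (z, r - sigma x z).
Proof.
move=> bad; apply: contrapT => nex; apply: bad => /=.
have fin z : adj x z -> finite_set [set y | d z y < r - sigma x z].
  by move=> xz; apply: contrapT => nf; apply: nex; exists z.
apply: (@sub_finite_set _ _ ([set x] `|` \bigcup_(z in [set z | adj x z])
    [set y | d z y < r - sigma x z])); last first.
  by rewrite finite_setU; split; [exact: finite_set1|exact: bigcup_finite].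
move=> y /= /path_metric_lt [[|z p] [/= xp lp lr]]; first by left.
case/andP: xp => xz zp; right; exists z => //=; apply/path_metric_lt.
by exists p; split => //; rewrite ltrBrDl -path_length_cons.
Qed.

Hypothesis d_complete : metrically_complete d.

(* An infinite ball yields an infinite path of finite length; its limit would
   be an accumulation point, but locally finite path metrics are discrete. *)
Lemma finite_balls x r : finite_set [set y | d x y < r].
Proof.
apply: contrapT => bad0.
(* States are pairs of a vertex and a remaining radius; on pairs with a finite ball the value of [f]
   is arbitrary. *)
have /choice [f fP] (p : X * R) : exists q : X * R, infinite_ball p ->
    [/\ adj p.1 q.1, infinite_ball q & q.2 = p.2 - sigma p.1 q.1].
  case: (pselect (infinite_ball p)) => [|nb]; last by exists p.
  case: p => y s /infinite_ball_step [z yz bz].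
  by exists (z, s - sigma y z).
pose p n := iter n f (x, r).
have bad n : infinite_ball (p n) by elim: n => [//|n /fP []].
have step n : adj (p n).1 (p n.+1).1 by have [] := fP _ (bad n).
have len_step n : (p n.+1).2 = (p n).2 - sigma (p n).1 (p n.+1).1.
  by have [] := fP _ (bad n).
(* A ball of nonpositive radius is empty, so the remaining radius never runs out. *)
have pos n : 0 < (p n).2.
  rewrite ltNge; apply/negP => neg; apply: (bad n).
  apply: (@sub_finite_set _ _ set0) => // y /= lt.
  by have := lt_le_trans lt neg; rewrite ltNge path_metric_ge0.
have dist i k : d (p i).1 (p (i + k)%N).1 <= (p i).2 - (p (i + k)%N).2.
  elim: k => [|k IH]; first by rewrite addn0 subrr /path_metric eqxx.
  rewrite addnS; apply: le_trans (path_metric_triangle _ (p (i + k)%N).1 _) _.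
  have xy := step (i + k)%N.
  have := @path_metric_le (p (i + k)%N).1 [:: (p (i + k).+1).1].
  rewrite /= xy path_length_cons path_length_nil => /(_ isT).
  by rewrite (len_step (i + k)%N); lra.
(* The remaining radii decrease and are bounded below, and their differences bound the distances. *)
have cauchy eps : 0 < eps -> exists N : nat, forall i j : nat,
    (N <= i)%N -> (N <= j)%N -> d (p i).1 (p j).1 < eps.
  move=> e0; pose E := range (fun n => (p n).2).
  have E0 : E !=set0 by exists (p 0%N).2; exists 0%N.
  have lb n : inf E <= (p n).2.
    by apply: ge_inf; [exists 0 => _ [k _ <-]; exact: ltW|exists n].
  have [|_ [N _ <-] lt] := @inf_lt _ E (inf E + eps) E0; first by rewrite ltrDl.
  have le_p i k : (p (i + k)%N).2 <= (p i).2.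
    by rewrite -subr_ge0; apply: le_trans (dist i k); exact: path_metric_ge0.
  have main i k : (N <= i)%N -> d (p i).1 (p (i + k)%N).1 < eps.
    move=> Ni; apply: le_lt_trans (dist i k) _.
    have := le_p N (i - N)%N; rewrite subnKC// => leN.
    by have := lb (i + k)%N; lra.
  exists N => i j Ni Nj; case/orP: (leq_total i j) => ij.
    by rewrite -(subnKC ij) main.
  by rewrite path_metric_sym -(subnKC ij) main.
have [y ylim] := d_complete cauchy.
have [e e0 ye] := path_metric_discrete y.
have [N HN] := ylim e e0.
(* By discreteness the sequence is eventually constant, yet consecutive vertices are adjacent and
   the graph has no loops. *)
have py n : (N <= n)%N -> (p n).1 = y.
  by move=> Nn; apply: ye; rewrite path_metric_sym HN.
have := step N; rewrite (py N (leqnn N)) (py N.+1 (leqnSn N)).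
by rewrite /Defs.adjacent weight_diag ltxx.
Qed.

(** * Cutoff functions of small gradient from an intrinsic metric *)

Hypothesis d_intrinsic : intrinsic G d.

Lemma intrinsic_sum_le x s : uniq s ->
  \sum_(y <- s) weight G x y * d x y ^+ 2 <= mass G x.
Proof.
move=> us; have := d_intrinsic x.
rewrite lee_pdivrMl ?mass_gt0// mule1; rewrite -lee_fin; apply: le_trans.
by apply: esum_ge_sum => // y; rewrite mulr_ge0 ?weight_ge0 ?sqr_ge0.
Qed.

(** Clamp [1 + k (r - d(x0, x))] to the unit interval, with [k^2 = eps] and [A] within distance [r]
    of [x0]. The result is [k]-Lipschitz, so the intrinsic bound controls its gradient, and it is
    supported in a ball, which is finite. *)
Lemma cutoff_exists (A : seq X) eps : 0 < eps -> exists eta : X -> R,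
  [/\ Cc R X eta, forall x, 0 <= eta x <= 1, forall x, x \in A -> eta x = 1 &
   forall x s, uniq s ->
     \sum_(y <- s) weight G x y * (eta x - eta y) ^+ 2 <= eps * mass G x].
Proof.
move=> e0; have [x0 _] := infinite_setN0 (vertices_infinite G).
(* The sum serves as an upper bound for the largest distance. *)
pose r := \sum_(x <- A) d x0 x.
have rA x : x \in A -> d x0 x <= r.
  move=> xA; rewrite /r (perm_big _ (perm_to_rem xA)) big_cons/= lerDl.
  by apply: sumr_ge0 => y _; exact: path_metric_ge0.
pose k := Num.sqrt eps; have k0 : 0 < k by rewrite sqrtr_gt0.
have k2 : k ^+ 2 = eps by rewrite sqr_sqrtr// ltW.
pose h x := 1 + k * (r - d x0 x).
pose eta x := Num.min 1 (Num.max 0 (h x)).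
have lip x y : (eta x - eta y) ^+ 2 <= (h x - h y) ^+ 2.
  exact: clamp_lipschitz.
exists eta; split.
- apply: (@sub_finite_set _ _ [set y | d x0 y < (1 + k * r) / k]).
    move=> y /=; apply: contra_neqT; rewrite -leNgt ler_pdivrMr// => le.
    have hy : h y <= 0 by rewrite /h; nra.
    by rewrite /eta max_l// min_r.
  exact: finite_balls.
- by move=> x; rewrite /eta le_min ge_min lexx ler01 le_max lexx.
- move=> x /rA xr; have h1 : 1 <= h x by rewrite /h; nra.
  by rewrite /eta max_r ?min_l//; lra.
- move=> x s us; apply: (@le_trans _ _
    (\sum_(y <- s) eps * (weight G x y * d x y ^+ 2))); last first.
    by rewrite -mulr_sumr ler_pM2l// intrinsic_sum_le.
  apply: ler_sum => y _; rewrite [leRHS]mulrCA ler_wpM2l ?weight_ge0//.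
  apply: le_trans (lip x y) _; have := path_metric_lipschitz x0 x y.
  have -> : h x - h y = k * (d x0 y - d x0 x) by rewrite /h; ring.
  by rewrite exprMn k2 -sqrrN opprB => ?; rewrite ler_pM2l.
Qed.

End PathMetric.

(** * Green's formula and the energy estimate *)

Lemma ge0_rsum_swap (R : realType) (T U : choiceType) (f : T * U -> R) :
  (forall p, 0 <= f p) -> summ f ->
  summ (fun p => f (p.2, p.1)) /\ rsum (fun p => f (p.2, p.1)) <= rsum f.
Proof.
move=> f0 sf; apply: rsum_le_bound => // s us.
rewrite -(big_map (fun p => (p.2, p.1)) xpredT f) sum_le_rsum//.
by rewrite map_inj_uniq// => -[? ?] [? ?] [-> ->].
Qed.

Section GraphCalculus.
Variables (R : realType) (X : countType) (G : weighted_graph R X).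
Implicit Types (u v f g phi eta : X -> R) (eps e : R).

Local Notation w := (weight G).
Local Notation mu := (mass G).
Local Notation Delta := (formal_laplacian G).

(** Each edge occurs as two ordered pairs; with the factor [1/2], the weighted inner product of
    gradients is the energy form. *)
Definition edge_mass (p : X * X) : R := w p.1 p.2 / 2.
Definition grad u (p : X * X) : R := u p.1 - u p.2.

Lemma mass_ge0 x : 0 <= mu x. Proof. by rewrite ltW ?mass_gt0. Qed.

Lemma edge_mass_ge0 p : 0 <= edge_mass p.
Proof. by rewrite divr_ge0 ?weight_ge0. Qed.

Lemma sqr2_edge_mass_ge0 (a b : R) p : 0 <= a ^+ 2 * b ^+ 2 * edge_mass p.
Proof. by rewrite -exprMn mulr_ge0 ?sqr_ge0 ?edge_mass_ge0. Qed.

Lemma Cc_fin phi : Cc R X phi <->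
  exists2 s, uniq s & forall x, x \notin s -> phi x = 0.
Proof.
split=> [/finite_seqP [s sE]|[s us phis]].
  exists (undup s) => [|x]; first exact: undup_uniq.
  rewrite mem_undup; apply: contraNeq => phix.
  have : [set x | phi x != 0] x by [].
  by rewrite sE.
apply: (@sub_finite_set _ _ [set` s]) => //.
by move=> x /=; apply: contra_neqT; exact: phis.
Qed.

Lemma Cc_sq_summ (m : X -> R) phi : Cc R X phi -> sq_summ m phi.
Proof.
move=> /Cc_fin [s us phis]; apply: (proj1 (@rsum_fin _ _ _ s us _)) => x xs.
by rewrite phis// expr0n mul0r.
Qed.

Lemma CcM u phi : Cc R X phi -> Cc R X (fun x => phi x * u x).
Proof.
by move=> /Cc_fin [s us phis]; apply/Cc_fin; exists s => // x xs; rewrite phis// mul0r.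
Qed.

Lemma CcD phi psi : Cc R X phi -> Cc R X psi -> Cc R X (phi \+ psi).
Proof.
move=> /Cc_fin [s us ps] /Cc_fin [t ut pt]; apply/Cc_fin.
exists (undup (s ++ t)) => [|x]; first exact: undup_uniq.
by rewrite mem_undup mem_cat negb_or => /andP[xs xt] /=; rewrite ps// pt// addr0.
Qed.

Lemma CcZ a phi : Cc R X phi -> Cc R X (a \*o phi).
Proof.
by move=> /(CcM (fun=> a)); congr Cc; apply/funext => x /=; rewrite mulrC.
Qed.

Lemma Cc0 : Cc R X (fun=> 0).
Proof. by apply/Cc_fin; exists [::]. Qed.

Lemma gradB u v : grad (u \- v) = grad u \- grad v.
Proof. by apply/funext => p; rewrite /grad/=; ring. Qed.

Lemma gradD u v : grad (u \+ v) = grad u \+ grad v.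
Proof. by apply/funext => p; rewrite /grad/=; ring. Qed.

Lemma gradZ a u : grad (a \*o u) = a \*o grad u.
Proof. by apply/funext => p; rewrite /grad/=; ring. Qed.

(** Summation by parts: exchanging [x] and [y] maps the part with [f y] to the part with [f x],
    since the weight is symmetric, and the two halves add up. *)
Lemma sum_symmetric_weight (N : seq X) f g :
  \sum_(x <- N) \sum_(y <- N) grad f (x, y) * grad g (x, y) * edge_mass (x, y) =
  \sum_(x <- N) f x * \sum_(y <- N) w x y * (g x - g y).
Proof.
pose F x y := f x * (g x - g y) * edge_mass (x, y).
transitivity (\sum_(x <- N) \sum_(y <- N) F x y +
    \sum_(x <- N) \sum_(y <- N) F y x).
  rewrite -big_split; apply: eq_bigr => x _; rewrite -big_split.
  apply: eq_bigr => y _; rewrite /F /edge_mass /grad/= (weight_sym G y x); ring.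
rewrite [X in _ + X]exchange_big/= -big_split; apply: eq_bigr => x _ /=.
rewrite -big_split mulr_sumr; apply: eq_bigr => y _ /=.
by rewrite /F /edge_mass /=; field.
Qed.

(** * Green's formula with a finitely supported function, and localized energy bounds *)

Hypothesis G_locally_finite : locally_finite G.

(** Take a finite set carrying [phi] together with all neighbors of its points; the sums in Green's
    formula then reduce to [N]. *)
Lemma Cc_neighborhood phi : Cc R X phi -> exists N, [/\ uniq N,
  forall x, x \notin N -> phi x = 0 &
  forall x y, phi x != 0 -> y \notin N -> w x y = 0].
Proof.
move=> /Cc_fin [s us phis].
have /choice [nb nbP] x : exists t : seq X, forall y, y \notin t -> w x y = 0.
  have /finite_seqP [t tE] := G_locally_finite x; exists t => y yt.
  apply/eqP; rewrite eq_le weight_ge0 andbT leNgt; apply: contra yt => xy.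
  by have : [set` t] y by rewrite -tE.
exists (undup (s ++ flatten (map nb s))); split; first exact: undup_uniq.
  by move=> x; rewrite mem_undup mem_cat negb_or => /andP[/phis].
move=> x y phix; rewrite mem_undup mem_cat negb_or => /andP[_ yn].
apply: nbP; apply: contra yn => yx; apply/flattenP; exists (nb x) => //.
by apply: map_f; apply: contra_neqT phix; exact: phis.
Qed.

Lemma formal_laplacian_fin (N : seq X) f x : uniq N ->
  (forall y, y \notin N -> w x y * (f x - f y) = 0) ->
  Delta f x * mu x = \sum_(y <- N) w x y * (f x - f y).
Proof.
move=> uN fN; have [_ <-] := rsum_fin uN fN.
by rewrite /formal_laplacian mulrAC mulVf ?mul1r// gt_eqF// mass_gt0.
Qed.

(** All sums are finite because [phi] has finite support, so [u] may be arbitrary; summation by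
    parts then moves the Laplacian to either function. *)
Lemma green u phi : Cc R X phi ->
  [/\ summ (fun p => grad u p * grad phi p * edge_mass p),
   ip edge_mass (grad u) (grad phi) = ip mu (Delta u) phi,
   ip edge_mass (grad u) (grad phi) = ip mu u (Delta phi) &
   Cc R X (Delta phi)].
Proof.
move=> /Cc_neighborhood [N [uN phiN wN]].
have wN' x y : y \notin N -> w y x * phi x = 0.
  move=> yN; have [->|px] := eqVneq (phi x) 0; first by rewrite mulr0.
  by rewrite weight_sym wN// mul0r.
pose NN := [seq (x, y) | x <- N, y <- N].
have uNN : uniq NN by rewrite allpairs_uniq// => -[? ?] [? ?].
have [p|sp pE] := @rsum_fin _ _
    (fun p => grad u p * grad phi p * edge_mass p) NN uNN.
  case: p => x y pN; rewrite /grad /edge_mass/=.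
  have [xN|xN] := boolP (x \in N); have [yN|yN] := boolP (y \in N).
  - case/negP: pN; apply/allpairsP; exists (x, y); by split.
  - rewrite (phiN y)//; have [->|px] := eqVneq (phi x) 0.
      by rewrite subrr mulr0 mul0r.
    by rewrite (wN x y)// mul0r mulr0.
  - rewrite (phiN x)//; have [->|px] := eqVneq (phi y) 0.
      by rewrite subrr mulr0 mul0r.
    by rewrite (weight_sym G x y) (wN y x)// mul0r mulr0.
  - by rewrite !phiN// subrr mulr0 mul0r.
have E1 : ip edge_mass (grad u) (grad phi) =
    \sum_(x <- N) \sum_(y <- N) grad u (x, y) * grad phi (x, y) * edge_mass (x, y).
  by rewrite [LHS]pE big_allpairs.
(* Outside [N], [phi] vanishes at the point and at all its neighbors. *)
have DphiN x : x \notin N -> Delta phi x = 0.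
  move=> xN; apply: (mulIf (lt0r_neq0 (mass_gt0 G x))); rewrite mul0r.
  rewrite (@formal_laplacian_fin [::])// ?big_nil// => y _.
  by rewrite mulrBr wN'// (phiN x)// mulr0 subrr.
split => //; last by apply/Cc_fin; exists N.
- rewrite E1; have [x xN|_ rE] := @rsum_fin _ _
      (fun x => Delta u x * phi x * mu x) N uN.
    by rewrite phiN// mulr0 mul0r.
  rewrite [RHS]rE.
  (* Summation by parts leaves its first function undifferentiated: here this must be [phi], in the
     other identity it is [u]. *)
  under eq_bigr do under eq_bigr do rewrite [X in X * _]mulrC.
  rewrite sum_symmetric_weight; apply: eq_bigr => x _.
  have [->|px] := eqVneq (phi x) 0; first by rewrite mulr0 !mul0r.
  rewrite -(@formal_laplacian_fin N)//; first by ring.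
  by move=> y yN; rewrite (wN x y)// mul0r.
- rewrite E1; have [x xN|_ rE] := @rsum_fin _ _
      (fun x => u x * Delta phi x * mu x) N uN.
    by rewrite DphiN// mulr0 mul0r.
  rewrite [RHS]rE.
  rewrite sum_symmetric_weight; apply: eq_bigr => x _.
  rewrite -mulrA (@formal_laplacian_fin N)// => y yN.
  have [px|px] := eqVneq (phi x) 0; last by rewrite (wN x y)// mul0r.
  by rewrite px (phiN y)// subrr mulr0.
Qed.

Lemma Cc_grad phi : Cc R X phi -> sq_summ edge_mass (grad phi).
Proof. by move=> /(green phi) []. Qed.

(** Finite partial sums are the form in which [rsum_prod_le] takes its row bounds. *)
Definition cutoff_bound eta eps := forall x s, uniq s ->
  \sum_(y <- s) w x y * (eta x - eta y) ^+ 2 <= eps * mu x.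

(** Sum over the second vertex first; the [1/2] comes from [edge_mass]. [F'] is [F] with the two
    vertices exchanged. *)
Lemma grad_cutoff_bound u eta eps : 0 <= eps -> cutoff_bound eta eps ->
  sq_summ mu u ->
  let F p := u p.1 ^+ 2 * grad eta p ^+ 2 * edge_mass p in
  let F' p := u p.2 ^+ 2 * grad eta p ^+ 2 * edge_mass p in
  [/\ summ F, summ F', rsum F <= eps / 2 * ip mu u u &
   rsum F' <= eps / 2 * ip mu u u].
Proof.
move=> e0 etab su F F'.
have F0 p : 0 <= F p by exact: sqr2_edge_mass_ge0.
have [||x s us|sF rF] := @rsum_prod_le _ _ _ F
    (fun x => eps / 2 * (u x ^+ 2 * mu x)) F0.
- by move=> x; rewrite mulr_ge0 ?divr_ge0// mulr_ge0 ?sqr_ge0 ?mass_ge0.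
- exact: summZ.
- have := etab x s us; rewrite -(@ler_pM2l _ 2^-1)// => le.
  apply: (@le_trans _ _ (u x ^+ 2 * (2^-1 * (eps * mu x)))); last first.
    by rewrite le_eqVlt; apply/orP; left; apply/eqP; field.
  apply: (le_trans _ (ler_wpM2l (sqr_ge0 (u x)) le)); rewrite !mulr_sumr.
  apply/ler_sum => y _.
  by rewrite /F /grad /edge_mass/= le_eqVlt; apply/orP; left; apply/eqP; field.
have rF' : rsum F <= eps / 2 * ip mu u u by rewrite -rsumZ.
have [sw rw] := ge0_rsum_swap F0 sF.
have FE : F' = fun p => F (p.2, p.1).
  apply/funext => p; rewrite /F /F' /grad /edge_mass/= (weight_sym G p.2); ring.
by split => //; rewrite FE// (le_trans rw).
Qed.

Lemma ip_mul_le eta u : (forall x, 0 <= eta x <= 1) -> sq_summ mu u ->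
  sq_summ mu (fun x => eta x * u x) /\
  ip mu (fun x => eta x * u x) (fun x => eta x * u x) <= ip mu u u.
Proof.
move=> eta01 su; have le x : (eta x * u x) ^+ 2 <= u x ^+ 2.
  have /andP[e0 e1] := eta01 x; rewrite exprMn ler_piMl ?sqr_ge0//.
  by rewrite expr_le1.
by split; [exact: (sq_summ_le mass_ge0 le su)|exact: (ip_le mass_ge0 le su)].
Qed.

(* [grad (eta u) ^ 2 = grad u * grad (eta ^ 2 u) + u(x) u(y) (grad eta) ^ 2] *)
Lemma energy_localized_le eta u eps : 0 <= eps -> Cc R X eta ->
  (forall x, 0 <= eta x <= 1) -> cutoff_bound eta eps ->
  sq_summ mu u -> sq_summ mu (Delta u) ->
  ip edge_mass (grad (fun x => eta x * u x)) (grad (fun x => eta x * u x)) <=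
  (ip mu (Delta u) (Delta u) + ip mu u u) / 2 + eps / 2 * ip mu u u.
Proof.
move=> e0 ceta eta01 etab su sDu.
have [sF sF' rF rF'] := grad_cutoff_bound e0 etab su.
pose v x := eta x * u x; pose psi x := eta x * v x.
have cpsi : Cc R X psi by exact: CcM.
have [sg gE _ _] := green u cpsi.
have [sv vu] := ip_mul_le eta01 su.
have [spsi psiv] := ip_mul_le eta01 sv.
pose K p := u p.1 * u p.2 * grad eta p ^+ 2 * edge_mass p.
pose F p := u p.1 ^+ 2 * grad eta p ^+ 2 * edge_mass p.
pose F' p := u p.2 ^+ 2 * grad eta p ^+ 2 * edge_mass p.
have sFF : summ (fun p => 2^-1 * (F p + F' p)) by apply: summZ; exact: summD.
have KF p : `|K p| <= 2^-1 * (F p + F' p).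
  have -> : 2^-1 * (F p + F' p) =
      (u p.1 ^+ 2 + u p.2 ^+ 2) / 2 * (grad eta p ^+ 2 * edge_mass p).
    by rewrite /F /F'; field.
  rewrite /K -mulrA normrM (@ger0_norm _ (_ * edge_mass p)); last first.
    by rewrite mulr_ge0 ?sqr_ge0 ?edge_mass_ge0.
  apply: ler_wpM2r; first by rewrite mulr_ge0 ?sqr_ge0 ?edge_mass_ge0.
  move: (u p.1) (u p.2) => a b; rewrite ler_norml.
  have := sqr_ge0 (a - b); have := sqr_ge0 (a + b).
  by move=> ? ?; apply/andP; split; nra.
have sK : summ K by exact: le_summ sFF.
(* As [psi = eta^2 u] is finitely supported, Green's formula is available before the energy of [u]
   is known to be finite. *)
have -> : ip edge_mass (grad v) (grad v) = ip mu (Delta u) psi + rsum K.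
  rewrite -gE -rsumD//; congr rsum; apply/funext => p.
  by rewrite /K /psi /v /grad; ring.
have KE : rsum K <= eps / 2 * ip mu u u.
  apply: (@le_trans _ _ (rsum (fun p => 2^-1 * (F p + F' p)))).
    by apply: ler_rsum => // p; exact: le_trans (ler_norm _) (KF p).
  by rewrite rsumZ ?rsumD//; [lra|exact: summD].
(* Young's inequality with [t = 1]; the norm of [psi] is at most that of [u]. *)
have := ip_young mass_ge0 1 sDu spsi.
by rewrite expr1n mulr1 mul1r; lra.
Qed.

(** * Finite energy, density and the general Green's formula from cutoffs *)

Hypothesis cutoffs : forall (A : seq X) (eps : R), 0 < eps -> exists eta,
  [/\ Cc R X eta, forall x, 0 <= eta x <= 1, forall x, x \in A -> eta x = 1 &
   cutoff_bound eta eps].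

(** The localized bound with [eps = 1] is the constant [C], the same for every cutoff. Given
    finitely many edges, a cutoff equal to [1] at their endpoints does not change the gradient
    there. *)
Lemma grad_sq_summ u : sq_summ mu u -> sq_summ mu (Delta u) ->
  sq_summ edge_mass (grad u).
Proof.
move=> su sDu; pose C :=
  (ip mu (Delta u) (Delta u) + ip mu u u) / 2 + 1 / 2 * ip mu u u.
apply: (proj1 (@rsum_le_bound _ _ _ C _ _)) => [p|s us].
  by rewrite mulr_ge0 ?sqr_ge0 ?edge_mass_ge0.
have [eta [ceta eta01 etaA etab]] := cutoffs (map fst s ++ map snd s) ltr01.
apply: le_trans (energy_localized_le ler01 ceta eta01 etab su sDu).
have seu : sq_summ edge_mass (grad (fun x => eta x * u x)).
  by apply: Cc_grad; exact: CcM.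
apply: le_trans (@sum_le_rsum _ _ _ s _ seu us); last first.
  by move=> p; rewrite mulr_ge0 ?sqr_ge0 ?edge_mass_ge0.
rewrite big_seq [leRHS]big_seq; apply: ler_sum => p ps.
rewrite /grad !etaA ?mul1r// mem_cat; apply/orP.
  by right; exact: map_f.
by left; exact: map_f.
Qed.

(** The approximant is [eta v]. The gradient of the error splits into [(1 - eta) grad v], a tail of
    a convergent sum, and [v grad eta], which is small by the choice of [eta]. *)
Lemma Cc_energy_dense v e : sq_summ mu v -> sq_summ edge_mass (grad v) -> 0 < e ->
  exists2 g, Cc R X g & ip mu (v \- g) (v \- g) +
    ip edge_mass (grad (v \- g)) (grad (v \- g)) < e.
Proof.
move=> sv sgv e0; have e8 : 0 < e / 8 by lra.
have v0 x : 0 <= v x ^+ 2 * mu x by rewrite mulr_ge0 ?sqr_ge0 ?mass_ge0.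
have gv0 p : 0 <= grad v p ^+ 2 * edge_mass p.
  by rewrite mulr_ge0 ?sqr_ge0 ?edge_mass_ge0.
have [A1 tail1] := rsum_tail v0 sv e8.
have [A2 tail2] := rsum_tail gv0 sgv e8.
have vv := ip_ge0 mass_ge0 v; have vv1 : 0 < ip mu v v + 1 by lra.
(* The three contributions are then at most [e / 8], [e / 4] and [e / 8]. *)
pose eps := e / (8 * (ip mu v v + 1)).
have eps0 : 0 < eps by rewrite divr_gt0// mulr_gt0.
(* First endpoints suffice for [A2], since [H] contains [eta] only at [p.1]. *)
have [eta [ceta eta01 etaA etab]] := cutoffs (A1 ++ map fst A2) eps0.
exists (fun x => eta x * v x); first exact: CcM.
have b1 : ip mu (v \- (fun x => eta x * v x)) (v \- (fun x => eta x * v x)) <= e / 8.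
  apply: tail1 => x /= => [|xA]; last first.
    by rewrite etaA ?mem_cat ?xA// mul1r subrr !mul0r.
  rewrite -!expr2 mulr_ge0 ?sqr_ge0 ?mass_ge0//= ler_wpM2r ?mass_ge0//.
  have -> : v x - eta x * v x = (1 - eta x) * v x by ring.
  have /andP[h0 h1] := eta01 x; rewrite exprMn ler_piMl ?sqr_ge0//.
  by rewrite expr_le1// ?subr_ge0// lerBlDr lerDl.
have [_ sF' _ rF'] := grad_cutoff_bound (ltW eps0) etab sv.
pose F' p := v p.2 ^+ 2 * grad eta p ^+ 2 * edge_mass p.
pose H p := (1 - eta p.1) ^+ 2 * grad v p ^+ 2 * edge_mass p.
have Hle p : 0 <= H p <= grad v p ^+ 2 * edge_mass p.
  have /andP[h0 h1] := eta01 p.1.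
  rewrite sqr2_edge_mass_ge0/= ler_wpM2r ?edge_mass_ge0//.
  by rewrite ler_piMl ?sqr_ge0// expr_le1// ?subr_ge0// lerBlDr lerDl.
have sH : summ H.
  by apply: le_summ sgv => p; have /andP[? ?] := Hle p; rewrite ger0_norm.
have rH : rsum H <= e / 8.
  apply: tail2 => // p pA; rewrite /H etaA ?subrr ?expr0n ?mul0r//.
  by rewrite mem_cat map_f ?orbT.
have b2 : ip edge_mass (grad (v \- (fun x => eta x * v x)))
    (grad (v \- (fun x => eta x * v x))) <= 2 * rsum H + 2 * rsum F'.
  have sHF : summ (fun p => 2 * H p + 2 * F' p) by apply: summD; exact: summZ.
  have le p : grad (v \- (fun x => eta x * v x)) p ^+ 2 * edge_mass p <=
      2 * H p + 2 * F' p.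
    have -> : 2 * H p + 2 * F' p = (2 * ((1 - eta p.1) * grad v p) ^+ 2 +
      2 * (v p.2 * grad eta p) ^+ 2) * edge_mass p by rewrite /H /F'; ring.
    rewrite ler_wpM2r ?edge_mass_ge0//.
    have -> : grad (v \- (fun x => eta x * v x)) p =
      (1 - eta p.1) * grad v p - v p.2 * grad eta p by rewrite /grad/=; ring.
    move: (_ * grad v p) (_ * grad eta p) => a b.
    by have := sqr_ge0 (a + b); nra.
  rewrite -!rsumZ// -rsumD; [|exact: summZ..].
  apply: (ler_rsum _ _ le) => //; apply: le_summ sHF => p.
  rewrite ger0_norm ?le//.
  by rewrite mulr_ge0 ?sqr_ge0 ?edge_mass_ge0.
have ev : eps / 2 * ip mu v v <= e / 16.
  rewrite /eps; move: (ip mu v v) vv vv1 => a a0 a1.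
  have -> : e / (8 * (a + 1)) / 2 * a = e / 16 * (a / (a + 1)).
    by field; rewrite gt_eqF.
  by rewrite ler_piMr ?ler_pdivrMr ?mul1r//; lra.
rewrite -/F' in rF'; clear -b1 b2 rH rF' ev e0.
by lra.
Qed.

(** Both sides are continuous in [v] for the energy norm, the left one because [u] has finite
    energy, and they agree on the dense set of finitely supported functions. *)
Lemma green_energy u v : sq_summ mu u -> sq_summ mu (Delta u) ->
  sq_summ mu v -> sq_summ edge_mass (grad v) ->
  ip edge_mass (grad u) (grad v) = ip mu (Delta u) v.
Proof.
move=> su sDu sv sgv; have sgu := grad_sq_summ su sDu.
apply/eqP; rewrite -subr_eq0 -normr_le0; apply/ler_addgt0Pr => e e0.
have e2 : 0 < e / 2 by lra.
have [d1 d10 Hd1] := ip_small edge_mass_ge0 sgu e2.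
have [d2 d20 Hd2] := ip_small mass_ge0 sDu e2.
have d0 : 0 < Num.min d1 d2 by rewrite lt_min d10.
have [g cg] := Cc_energy_dense sv sgv d0; rewrite lt_min => /andP[].
have [_ gE _ _] := green u cg.
have sg := Cc_sq_summ mu cg; have sgg := Cc_grad cg.
have sB := sq_summB mass_ge0 sv sg.
have sgB := sq_summB edge_mass_ge0 sgv sgg; rewrite -gradB in sgB.
have := ip_ge0 mass_ge0 (v \- g); have := ip_ge0 edge_mass_ge0 (grad (v \- g)).
move=> p1 p2 lt1 lt2.
have h1 : `|ip edge_mass (grad u) (grad (v \- g))| < e / 2 by apply: Hd1 => //; lra.
have h2 : `|ip mu (Delta u) (v \- g)| < e / 2 by apply: Hd2 => //; lra.
rewrite gradB in h1; rewrite ipBr// in h1; last exact: edge_mass_ge0.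
rewrite ipBr// in h2; last exact: mass_ge0.
rewrite gE in h1; rewrite add0r.
rewrite (_ : _ - _ = (ip edge_mass (grad u) (grad v) - ip mu (Delta u) g) -
  (ip mu (Delta u) v - ip mu (Delta u) g)); last by ring.
by apply: le_trans (ler_normB _ _) _; lra.
Qed.

End GraphCalculus.

(** * The Laplacian and its self-adjointness *)

Section Norms.
Variables (R : realType) (X : countType) (G : weighted_graph R X).
Implicit Types (u v f g : X -> R) (e : R).

Local Notation mu := (mass G).
Local Notation ew := (edge_mass G).

Lemma L2P u : L2 mu u <-> sq_summ mu u.
Proof.
have u0 x : 0 <= u x ^+ 2 * mu x by rewrite mulr_ge0 ?sqr_ge0 ?mass_ge0.
rewrite /L2/= /l2norm; split.
  move=> lt; apply/summ_ge0E => //; move: lt.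
  by case: (esum _ _) => // r _; rewrite ltry.
by move=> su; rewrite esum_rsum// ltry.
Qed.

Lemma l2normE u : sq_summ mu u -> l2norm mu u = (Num.sqrt (ip mu u u))%:E.
Proof.
move=> su; rewrite /l2norm esum_rsum// => x.
by rewrite mulr_ge0 ?sqr_ge0 ?mass_ge0.
Qed.

Lemma sqrte_lt (a e : R) : 0 <= a -> 0 < e ->
  (sqrte a%:E < e%:E)%E <-> a < e ^+ 2.
Proof.
move=> a0 e0; rewrite /= lte_fin -(sqr_sqrtr a0) sqrtr_sqr.
rewrite ger0_norm ?sqrtr_ge0//; have := sqrtr_ge0 a.
by move: (Num.sqrt a) => s s0; split; nra.
Qed.

Lemma l2norm_lt u e : sq_summ mu u -> 0 < e ->
  (l2norm mu u < e%:E)%E <-> ip mu u u < e ^+ 2.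
Proof.
move=> su e0; rewrite l2normE//; apply: (sqrte_lt _ e0).
by apply: ip_ge0 => x; exact: mass_ge0.
Qed.

Lemma l2norm_sqr u : sq_summ mu u -> (l2norm mu u ^+ 2)%E = (ip mu u u)%:E.
Proof.
move=> su; rewrite l2normE// -EFin_expe sqr_sqrtr//.
by apply: ip_ge0 => x; exact: mass_ge0.
Qed.

Let energy_term_ge0 u p : 0 <= weight G p.1 p.2 * (u p.1 - u p.2) ^+ 2.
Proof. by rewrite mulr_ge0 ?sqr_ge0 ?weight_ge0. Qed.

Let edge_termE u : (fun p => grad u p ^+ 2 * ew p) =
  fun p => 2^-1 * (weight G p.1 p.2 * (u p.1 - u p.2) ^+ 2).
Proof. by apply/funext => p; rewrite /grad /edge_mass; field. Qed.

Lemma energyE u : sq_summ ew (grad u) ->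
  energy G u = (ip ew (grad u) (grad u))%:E.
Proof.
move=> su; have s2 : summ (fun p => weight G p.1 p.2 * (u p.1 - u p.2) ^+ 2).
  have := summZ 2 su; congr summ.
  by apply/funext => p; rewrite /grad /edge_mass; field.
rewrite /energy (esum_rsum (energy_term_ge0 u) s2) -EFinM -rsumZ//.
by rewrite ipE edge_termE.
Qed.

Lemma energy_lty u : (energy G u < +oo)%E <-> sq_summ ew (grad u).
Proof.
split=> [lt|/energyE ->]; last by rewrite ltry.
rewrite /sq_summ edge_termE; apply: summZ.
apply/summ_ge0E; first exact: energy_term_ge0.
rewrite ltey; apply/eqP => eqy; move: lt; rewrite /energy eqy.
by rewrite gt0_muley ?lte_fin// ltxx.
Qed.

Lemma energy_formE u v : sq_summ ew (grad u) -> sq_summ ew (grad v) ->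
  energy_form G u v = ip ew (grad u) (grad v).
Proof.
move=> su sv; have e0 p := edge_mass_ge0 G p.
have sD := sq_summD e0 su sv; have sB := sq_summB e0 su sv.
rewrite -gradD in sD; rewrite -gradB in sB.
rewrite /energy_form !energyE//= gradD gradB (ip_sqrD e0 su sv) (ip_sqrB e0 su sv).
by field.
Qed.

Lemma energy_norm_lt u e : sq_summ mu u -> sq_summ ew (grad u) -> 0 < e ->
  (energy_norm G u < e%:E)%E <->
  ip mu u u + ip ew (grad u) (grad u) < e ^+ 2.
Proof.
move=> su sgu e0; rewrite /energy_norm energyE// l2norm_sqr// -EFinD addrC.
apply: (sqrte_lt _ e0); rewrite addr_ge0// ip_ge0// => x.
  exact: mass_ge0.
exact: edge_mass_ge0.
Qed.

Lemma form_norm_lt u e : sq_summ mu u -> sq_summ ew (grad u) -> 0 < e ->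
  (form_norm mu (energy_form G) u < e%:E)%E <->
  ip mu u u + ip ew (grad u) (grad u) < e ^+ 2.
Proof.
move=> su sgu e0; rewrite -energy_norm_lt//.
by rewrite /form_norm /energy_norm energyE// energy_formE.
Qed.

Lemma Cc_dense : dense_in_L2 mu (Cc R X).
Proof.
move=> u /L2P su e e0; have e2 : 0 < e ^+ 2 / 2 by rewrite divr_gt0 ?exprn_gt0.
have u0 x : 0 <= u x ^+ 2 * mu x by rewrite mulr_ge0 ?sqr_ge0 ?mass_ge0.
have [s tail] := rsum_tail u0 su e2.
have cv : Cc R X (fun x => if x \in s then u x else 0).
  apply/Cc_fin; exists (undup s) => [|x]; first exact: undup_uniq.
  by rewrite mem_undup => /negPf ->.
exists (fun x => if x \in s then u x else 0) => //.
apply/l2norm_lt => //.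
  by apply: sq_summB => [x||]; [exact: mass_ge0|by []|exact: Cc_sq_summ].
apply: (@le_lt_trans _ _ (e ^+ 2 / 2)); last by have := exprn_gt0 2 e0; lra.
apply: tail => [x|x xs] /=; last by rewrite xs subrr !mul0r.
case: ifP => _; first by rewrite subrr !mul0r lexx u0.
by rewrite subr0 -expr2 u0 lexx.
Qed.

End Norms.

(** * The Laplacian as the maximal operator, its core and its Dirichlet form *)

Section Operators.
Variables (R : realType) (X : countType) (G : weighted_graph R X).
Hypothesis G_locally_finite : locally_finite G.
Hypothesis cutoffs : forall (A : seq X) (eps : R), 0 < eps -> exists eta,
  [/\ Cc R X eta, forall x, 0 <= eta x <= 1, forall x, x \in A -> eta x = 1 &
   cutoff_bound G eta eps].
Implicit Types (u v f g phi : X -> R).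

Local Notation mu := (mass G).
Local Notation ew := (edge_mass G).
Local Notation Delta := (formal_laplacian G).
Let m0 x : 0 <= mu x. Proof. exact: mass_ge0. Qed.
Let ew0 p : 0 <= ew p. Proof. exact: edge_mass_ge0. Qed.

(** Cutting off approximates every L2 function of finite energy by finitely supported ones, so the
    smallest and the largest form domain coincide. *)
Lemma form_domainP u :
  form_domain G u <-> sq_summ mu u /\ sq_summ ew (grad u).
Proof.
split=> [[/L2P su /energy_lty sgu _]//|[su sgu]].
split; [exact/L2P|exact/energy_lty|move=> e e0].
have [g cg ge] := Cc_energy_dense cutoffs su sgu (exprn_gt0 2 e0).
have sg := Cc_sq_summ mu cg; have sgg := Cc_grad G_locally_finite cg.
exists g => //; apply/energy_norm_lt => //; first exact: sq_summB.
by rewrite gradB; exact: sq_summB.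
Qed.

Lemma formal_laplacian_summ u x : summ (fun y => weight G x y * (u x - u y)).
Proof.
have /finite_seqP [t tE] := G_locally_finite x.
apply: (proj1 (@rsum_fin _ _ _ (undup t) (undup_uniq t) _)) => y.
rewrite mem_undup => yt; suff -> : weight G x y = 0 by rewrite mul0r.
apply/eqP; rewrite eq_le weight_ge0 andbT leNgt; apply: contra yt => xy.
by have : [set` t] y by rewrite -tE.
Qed.

Lemma formal_laplacianD u v : Delta (u \+ v) = Delta u \+ Delta v.
Proof.
apply/funext => x; rewrite /formal_laplacian /= -mulrDr.
rewrite -(rsumD (formal_laplacian_summ u x) (formal_laplacian_summ v x)).
by under [in RHS]eq_fun do rewrite -mulrDr addrACA -opprD.
Qed.

Lemma formal_laplacianZ a u : Delta (a \*o u) = a \*o Delta u.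
Proof.
apply/funext => x; rewrite /formal_laplacian /= [RHS]mulrCA.
rewrite -(rsumZ a (formal_laplacian_summ u x)).
by under [in RHS]eq_fun do rewrite mulrCA mulrBr.
Qed.

Lemma formal_laplacianB u v : Delta (u \- v) = Delta u \- Delta v.
Proof.
have -> : u \- v = u \+ -1 \*o v by apply/funext => x /=; rewrite mulN1r.
by rewrite formal_laplacianD formal_laplacianZ; apply/funext => x /=; ring.
Qed.

Lemma formal_laplacian0 : Delta (fun=> 0) = fun=> 0.
Proof.
have -> : (fun=> 0) = 0 \*o (fun=> 0) :> (X -> R).
  by apply/funext => x /=; rewrite mul0r.
by rewrite formal_laplacianZ; apply/funext => x /=; rewrite !mul0r.
Qed.

Definition point_mass (x y : X) : R := (y == x)%:R.

Lemma Cc_point_mass x : Cc R X (point_mass x).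
Proof.
apply/Cc_fin; exists [:: x] => // y; rewrite inE /point_mass.
by move=> /negPf ->.
Qed.

Lemma ip_point_mass f x : ip mu f (point_mass x) = f x * mu x.
Proof.
have [y|_ pE] := @rsum_fin _ _ (fun y => f y * point_mass x y * mu y) [:: x] isT.
  by rewrite inE /point_mass => /negPf ->; rewrite mulr0 mul0r.
by rewrite [LHS]pE big_seq1 /point_mass eqxx mulr1.
Qed.

Lemma ip_point_mass_inj f g :
  (forall x, ip mu f (point_mass x) = ip mu g (point_mass x)) -> f = g.
Proof.
move=> fg; apply/funext => x; apply: (mulIf (lt0r_neq0 (mass_gt0 G x))).
by rewrite -!ip_point_mass.
Qed.

(** Testing the form identity on point masses identifies [f] with [Delta u]. Conversely, [u] has
    finite energy and the general Green's formula is the form identity. *)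
Lemma laplacianP u f :
  laplacian G (u, f) <-> [/\ sq_summ mu u, sq_summ mu f & f = Delta u].
Proof.
split=> [[/= /form_domainP [su sgu] /L2P sf Hf]|[su sf fE]].
  split=> //; apply: ip_point_mass_inj => x; have cx := Cc_point_mass x.
  have sx := Cc_sq_summ mu cx; have sgx := Cc_grad G_locally_finite cx.
  rewrite -Hf; last by apply/form_domainP.
  by rewrite energy_formE//; have [_ ->] := green G_locally_finite u cx.
subst f; have sgu := grad_sq_summ G_locally_finite cutoffs su sf.
split=> /=; [exact/form_domainP|exact/L2P|move=> v /form_domainP [sv sgv]].
rewrite energy_formE//.
exact (green_energy G_locally_finite cutoffs su sf sv sgv).
Qed.

Lemma minimal_laplacian_sub : minimal_laplacian G `<=` laplacian G.
Proof.
move=> [u f] [/= cu ->]; have [_ _ _ cDu] := green G_locally_finite u cu.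
by apply/laplacianP; split => //; exact: Cc_sq_summ.
Qed.

(** Pairing [u] with the Laplacian of a point mass reads off [Delta u] there, so the adjoint is the
    maximal operator. *)
Lemma adjoint_minimal_laplacian : adjoint mu (minimal_laplacian G) = laplacian G.
Proof.
apply/seteqP; split=> [[u f] [/= /L2P su /L2P sf Huf]|[u f]].
  apply/laplacianP; split => //; apply/esym/ip_point_mass_inj => x.
  have cx := Cc_point_mass x.
  have [_ <- -> _] := green G_locally_finite u cx.
  by rewrite ipC (ipC _ f); exact: (Huf _ _ (conj cx erefl)).
move=> /laplacianP [su sf fE]; subst f; split=> /=; [exact/L2P|exact/L2P|].
move=> phi _ [/= cphi ->]; have [_ E1 E2 _] := green G_locally_finite u cphi.
by rewrite ipC -E2 E1 ipC.
Qed.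

Lemma adjoint_sub (S T : set ((X -> R) * (X -> R))) : S `<=` T ->
  adjoint mu T `<=` adjoint mu S.
Proof. by move=> ST p [p1 p2 Hp]; split => // u f /ST; exact: Hp. Qed.

(** Both sides equal the energy pairing of [u] and [v]. *)
Lemma laplacian_ip_sym u v : sq_summ mu u -> sq_summ mu (Delta u) ->
  sq_summ mu v -> sq_summ mu (Delta v) -> ip mu (Delta u) v = ip mu u (Delta v).
Proof.
move=> su sDu sv sDv.
have sgu := grad_sq_summ G_locally_finite cutoffs su sDu.
have sgv := grad_sq_summ G_locally_finite cutoffs sv sDv.
rewrite -(green_energy G_locally_finite cutoffs su sDu sv sgv) ipC.
by rewrite (green_energy G_locally_finite cutoffs sv sDv su sgu) ipC.
Qed.

Lemma laplacian_ip_ge0 u : sq_summ mu u -> sq_summ mu (Delta u) ->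
  0 <= ip mu (Delta u) u.
Proof.
move=> su sDu; have sgu := grad_sq_summ G_locally_finite cutoffs su sDu.
by rewrite -(green_energy G_locally_finite cutoffs su sDu su sgu) ip_ge0.
Qed.

(** Adjoints reverse inclusions, so the adjoint lies in that of the minimal operator, which is the
    Laplacian; the other inclusion is symmetry. *)
Lemma adjoint_laplacian : adjoint mu (laplacian G) = laplacian G.
Proof.
apply/seteqP; split.
  rewrite -[X in _ `<=` X]adjoint_minimal_laplacian.
  exact/adjoint_sub/minimal_laplacian_sub.
move=> [u f] /laplacianP [su sf fE]; subst f.
split=> /=; [exact/L2P|exact/L2P|move=> v g /laplacianP [sv sg gE]; subst g].
exact: laplacian_ip_sym.
Qed.

Lemma laplacian_operator : is_operator mu (laplacian G).
Proof.
split.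
- by move=> [u f] /laplacianP [su sf _]; split; exact/L2P.
- apply/laplacianP; split; [exact: sq_summ0|exact: sq_summ0|].
  by rewrite formal_laplacian0.
- move=> u v f g /laplacianP [su sf fE] /laplacianP [sv sg gE]; subst f g.
  apply/laplacianP; rewrite formal_laplacianD.
  by split; [exact: sq_summD|exact: sq_summD|].
- move=> a u f /laplacianP [su sf fE]; subst f.
  apply/laplacianP; rewrite formal_laplacianZ.
  by split; [exact: sq_summZ|exact: sq_summZ|].
- by move=> u f g /laplacianP [_ _ ->] /laplacianP [_ _ ->].
Qed.

Lemma minimal_laplacian_operator : is_operator mu (minimal_laplacian G).
Proof.
have [sub _ _ _ fn] := laplacian_operator; split.
- by move=> p /minimal_laplacian_sub /sub.
- by split; [exact: Cc0|rewrite formal_laplacian0].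
- move=> u v f g [/= cu ->] [/= cv ->]; split=> /=; first exact: CcD.
  by rewrite formal_laplacianD.
- move=> a u f [/= cu ->]; split=> /=; first exact: CcZ.
  by rewrite formal_laplacianZ.
- by move=> u f g /minimal_laplacian_sub uf /minimal_laplacian_sub; exact: fn.
Qed.

Lemma minimal_laplacian_dense : dense_in_L2 mu (dom (minimal_laplacian G)).
Proof.
move=> u /Cc_dense H e /H [v cv lt]; exists v => //.
by exists (Delta v).
Qed.

Lemma laplacian_self_adjoint : self_adjoint mu (laplacian G).
Proof.
split; [exact: laplacian_operator| |exact: adjoint_laplacian].
move=> u /minimal_laplacian_dense H e /H [v [f vf] lt]; exists v => //.
by exists f; exact: minimal_laplacian_sub.
Qed.

(* A function [g] orthogonal to the range of [1 + Delta] on [Cc] satisfies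
   [Delta g = - g], and then [g = 0] because the energy of [g] is nonnegative. *)
Lemma shifted_laplacian_dense f e : sq_summ mu f -> 0 < e ->
  exists2 phi, Cc R X phi &
    ip mu (f \- (phi \+ Delta phi)) (f \- (phi \+ Delta phi)) < e.
Proof.
pose D := [set phi \+ Delta phi | phi in Cc R X].
have scD phi : Cc R X phi -> sq_summ mu (phi \+ Delta phi).
  move=> cphi; have [_ _ _ cD] := green G_locally_finite phi cphi.
  by apply: sq_summD => //; exact: Cc_sq_summ.
have sD : Defs.subspace D.
  split.
  - exists (fun=> 0); first exact: Cc0.
    by rewrite formal_laplacian0; apply/funext => x /=; rewrite addr0.
  - move=> _ _ [u cu <-] [v cv <-]; exists (u \+ v); first exact: CcD.
    by rewrite formal_laplacianD; apply/funext => x /=; ring.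
  - move=> a _ [u cu <-]; exists (a \*o u); first exact: CcZ.
    by rewrite formal_laplacianZ; apply/funext => x /=; ring.
have DL2 : D `<=` sq_summ mu by move=> _ [phi cphi <-]; exact: scD.
move=> sf e0; have [|_ [phi cphi <-] lt] :=
  subspace_dense (mass_gt0 G) sD DL2 _ sf e0; last by exists phi.
move=> g sg Hg; have DgE : Delta g = -1 \*o g.
  apply: ip_point_mass_inj => x; have cx := Cc_point_mass x.
  have [_ E1 E2 cDx] := green G_locally_finite g cx.
  have sx := Cc_sq_summ mu cx; have sDx := Cc_sq_summ mu cDx.
  have := Hg (point_mass x \+ Delta (point_mass x)).
  rewrite ipDr// -E2 E1 ipZl// => H.
  by apply/eqP; rewrite mulN1r -addr_eq0 addrC H//; exists (point_mass x).
apply: (ip_eq0 (mass_gt0 G) sg).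
have sDg : sq_summ mu (Delta g) by rewrite DgE; exact: sq_summZ.
have := laplacian_ip_ge0 sg sDg; rewrite DgE ipZl//; lra.
Qed.

(** The closure stays inside the Laplacian because the identity defining an adjoint survives limits.
    Conversely, approximating [(1 + Delta) u] by [(1 + Delta) phi] approximates [u] and [Delta u]
    simultaneously, as [Delta] is nonnegative. *)
Lemma operator_closure_minimal_laplacian :
  operator_closure mu (minimal_laplacian G) = laplacian G.
Proof.
apply/seteqP; split=> [[u f] [/= /L2P su /L2P sf Huf]|[u f]].
  rewrite -adjoint_laplacian; split=> /=; [exact/L2P|exact/L2P|].
  move=> v g /laplacianP [sv sg gE]; subst g.
  apply/eqP; rewrite -subr_eq0 -normr_le0; apply/ler_addgt0Pr => e e0.
  have e2 : 0 < e / 2 by lra.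
  have [d1 d10 Hd1] := ip_small m0 sg e2.
  have [d2 d20 Hd2] := ip_small m0 sv e2.
  (* [d1] and [d2] bound squared norms, whereas the closure is phrased with norms. *)
  pose d := Num.min (Num.sqrt d1) (Num.sqrt d2).
  have d0 : 0 < d by rewrite lt_min !sqrtr_gt0 d10.
  have dd1 : d ^+ 2 <= d1.
    rewrite -[leRHS](sqr_sqrtr (ltW d10)) ler_sqr ?nnegrE ?sqrtr_ge0 ?(ltW d0)//.
    by rewrite ge_min lexx.
  have dd2 : d ^+ 2 <= d2.
    rewrite -[leRHS](sqr_sqrtr (ltW d20)) ler_sqr ?nnegrE ?sqrtr_ge0 ?(ltW d0)//.
    by rewrite ge_min lexx orbT.
  have [[phi _] [/= cphi ->] []] := Huf d d0.
  have [_ E1 E2 cDphi] := green G_locally_finite v cphi.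
  have sphi := Cc_sq_summ mu cphi; have sDphi := Cc_sq_summ mu cDphi.
  have sB1 := sq_summB m0 su sphi; have sB2 := sq_summB m0 sf sDphi.
  move=> /(l2norm_lt sB1 d0) lt1 /(l2norm_lt sB2 d0) lt2.
  have := Hd1 _ sB1 (lt_le_trans lt1 dd1); rewrite ipBr// => h1.
  have := Hd2 _ sB2 (lt_le_trans lt2 dd2); rewrite ipBr// -E2 E1 => h2.
  rewrite add0r; apply: le_trans (_ : `|(ip mu (Delta v) u - ip mu (Delta v) phi) -
    (ip mu v f - ip mu (Delta v) phi)| <= e).
    by rewrite le_eqVlt; apply/orP; left; apply/eqP; congr `|_|; ring.
  by apply: le_trans (ler_normB _ _) _; lra.
move=> /laplacianP [su sf fE]; subst f.
split=> /=; [exact/L2P|exact/L2P|move=> e e0].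
have [phi cphi] := shifted_laplacian_dense (sq_summD m0 su sf) (exprn_gt0 2 e0).
have [_ _ _ cDphi] := green G_locally_finite phi cphi.
have sphi := Cc_sq_summ mu cphi; have sDphi := Cc_sq_summ mu cDphi.
have sw := sq_summB m0 su sphi; have sDw := sq_summB m0 sf sDphi.
have -> : (u \+ Delta u) \- (phi \+ Delta phi) =
    (u \- phi) \+ (Delta u \- Delta phi) by apply/funext => x /=; ring.
have := laplacian_ip_ge0 sw; rewrite formal_laplacianB => /(_ sDw).
(* For [w = u - phi] the mixed term of the square norm of [w + Delta w] is nonnegative, so each of
   the other two is below [e^2]. *)
rewrite ip_sqrD// (ipC _ (u \- phi)); have := ip_ge0 m0 (u \- phi).
have := ip_ge0 m0 (Delta u \- Delta phi) => p1 p2 p3 lt.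
exists (phi, Delta phi); first by split.
by split=> /=; apply/l2norm_lt => //; lra.
Qed.

(** Functions and gradients are Cauchy separately. The functions converge pointwise, hence so do the
    gradients, which identifies the limit of the latter as [grad u]. *)
Lemma energy_form_complete (u_ : nat -> X -> R) :
  (forall n, form_domain G (u_ n)) ->
  (forall eps : R, 0 < eps -> exists N : nat, forall i j : nat,
     (N <= i)%N -> (N <= j)%N ->
     (form_norm mu (energy_form G) (u_ i \- u_ j)%R < eps%:E)%E) ->
  exists2 u, form_domain G u & forall eps : R, 0 < eps -> exists N : nat,
    forall n : nat, (N <= n)%N ->
      (form_norm mu (energy_form G) (u_ n \- u)%R < eps%:E)%E.
Proof.
move=> Du cu; have su n : sq_summ mu (u_ n) by have /form_domainP [] := Du n.
have sgu n : sq_summ ew (grad (u_ n)) by have /form_domainP [] := Du n.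
have cauchy e : 0 < e -> exists N, forall i j, (N <= i)%N -> (N <= j)%N ->
    ip mu (u_ i \- u_ j) (u_ i \- u_ j) +
    ip ew (grad (u_ i \- u_ j)) (grad (u_ i \- u_ j)) < e.
  move=> e0; have [|N HN] := cu (Num.sqrt e); first by rewrite sqrtr_gt0.
  exists N => i j Ni Nj; have := HN i j Ni Nj.
  have sB := sq_summB m0 (su i) (su j).
  have sgB := sq_summB ew0 (sgu i) (sgu j); rewrite -gradB in sgB.
  move/(form_norm_lt sB sgB); rewrite sqrtr_gt0 => /(_ e0).
  by rewrite sqr_sqrtr// ltW.
have c1 : ip_cauchy mu u_.
  move=> e /cauchy [N HN]; exists N => i j Ni Nj; have := HN i j Ni Nj.
  by have := ip_ge0 ew0 (grad (u_ i \- u_ j)); lra.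
have c2 : ip_cauchy ew (fun n => grad (u_ n)).
  move=> e /cauchy [N HN]; exists N => i j Ni Nj; have := HN i j Ni Nj.
  by rewrite -gradB; have := ip_ge0 m0 (u_ i \- u_ j); lra.
have [u [uu su0 lim1]] := ip_complete (mass_gt0 G) su c1.
have [p|sgu0 lim2] := @ip_cauchy_lim _ _ _ ew0 _ (grad u) sgu c2.
  by apply: cvgB; exact: uu.
exists u; first exact/form_domainP.
move=> e e0; have e4 : 0 < e ^+ 2 / 4 by have := exprn_gt0 2 e0; lra.
have [N1 H1] := lim1 _ e4; have [N2 H2] := lim2 _ e4.
exists (maxn N1 N2) => n; rewrite geq_max => /andP[/H1 h1 /H2 h2].
apply/form_norm_lt => //; [exact: sq_summB|by rewrite gradB; exact: sq_summB|].
by rewrite gradB; lra.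
Qed.

(** A normal contraction shrinks [u] and its gradient pointwise in absolute value, hence both norms;
    closedness is the completeness above. *)
Lemma energy_form_dirichlet :
  dirichlet_form mu (energy_form G) (form_domain G).
Proof.
split; last first.
  move=> C u [C0 CL] /form_domainP [su sgu].
  have sqC s t : (C s - C t) ^+ 2 <= (s - t) ^+ 2.
    by rewrite -(real_normK (num_real (C s - C t))) -(real_normK (num_real (s - t)))
      ler_sqr ?nnegrE// CL.
  have le1 x : (C \o u) x ^+ 2 <= u x ^+ 2.
    by have := sqC (u x) 0; rewrite C0 !subr0.
  have le2 p : grad (C \o u) p ^+ 2 <= grad u p ^+ 2 by exact: sqC.
  have sCu : sq_summ mu (C \o u) by exact: (sq_summ_le m0 le1 su).
  have sgCu : sq_summ ew (grad (C \o u)) by exact: (sq_summ_le ew0 le2 sgu).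
  split; first exact/form_domainP.
  by rewrite !energy_formE//; exact: (ip_le ew0 le2 sgu).
split.
- by move=> u /form_domainP [su _]; exact/L2P.
- split.
  + apply/form_domainP; split; first exact: sq_summ0.
    by apply: (Cc_grad G_locally_finite); exact: Cc0.
  + move=> u v /form_domainP [su sgu] /form_domainP [sv sgv].
    by apply/form_domainP; rewrite gradD; split; exact: sq_summD.
  + move=> a u /form_domainP [su sgu].
    by apply/form_domainP; rewrite gradZ; split; exact: sq_summZ.
- move=> u /Cc_dense H e /H [v cv lt]; exists v => //; apply/form_domainP.
  by split; [exact: Cc_sq_summ|exact: Cc_grad].
- move=> u v /form_domainP [_ su] /form_domainP [_ sv].
  by rewrite !energy_formE// ipC.
- move=> u v v' /form_domainP [_ su] /form_domainP [_ sv] /form_domainP [_ sv'].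
  rewrite !energy_formE//; first by rewrite gradD ipDl.
  by rewrite gradD; exact: sq_summD.
- move=> a u v /form_domainP [_ su] /form_domainP [_ sv].
  rewrite !energy_formE//; first by rewrite gradZ ipZl.
  by rewrite gradZ; exact: sq_summZ.
- by move=> u /form_domainP [_ su]; rewrite energy_formE// ip_ge0.
- exact: energy_form_complete.
Qed.

Lemma laplacian_markovian_extension :
  markovian_extension mu (minimal_laplacian G) (laplacian G).
Proof.
split; [exact: laplacian_self_adjoint|exact: minimal_laplacian_sub|].
by exists (energy_form G), (form_domain G); split=> //; exact: energy_form_dirichlet.
Qed.

(** Taking adjoints of the inclusion of the minimal operator in [T] puts [T] inside the Laplacian;
    taking adjoints again reverses this inclusion. *)
Lemma self_adjoint_extension_unique T : self_adjoint mu T ->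
  minimal_laplacian G `<=` T -> laplacian G = T.
Proof.
move=> [_ _ Tadj] sub; have TL : T `<=` laplacian G.
  by rewrite -Tadj -adjoint_minimal_laplacian; exact: adjoint_sub.
apply/seteqP; split => //.
by rewrite -[X in X `<=` _]adjoint_laplacian -[X in _ `<=` X]Tadj; exact: adjoint_sub.
Qed.

End Operators.

Theorem theorem2 (R : realType) (X : countType) (G : weighted_graph R X)
    (sigma : X -> X -> R)
    (G_locally_finite : locally_finite G)
    (sigma_edge_length : edge_length G sigma)
    (d_intrinsic : intrinsic G (path_metric G sigma))
    (d_complete : metrically_complete (path_metric G sigma)) :
  [/\ dom (laplacian G) =
        [set u | L2 (mass G) u /\ L2 (mass G) (formal_laplacian G u)],
      essentially_self_adjoint (mass G) (minimal_laplacian G) &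
      exists! T, markovian_extension (mass G) (minimal_laplacian G) T].
Proof.
have cutoffs := cutoff_exists sigma_edge_length G_locally_finite d_complete
  d_intrinsic.
have lapP := laplacianP G_locally_finite cutoffs.
split.
- apply/seteqP; split=> u.
    by move=> [f /lapP [su sf fE]]; split; apply/L2P => //; rewrite -fE.
  by move=> [/L2P su /L2P sDu]; exists (formal_laplacian G u); exact/lapP.
- split; first exact: minimal_laplacian_operator.
    exact: minimal_laplacian_dense.
  by rewrite operator_closure_minimal_laplacian//; exact: laplacian_self_adjoint.
- exists (laplacian G); split; first exact: laplacian_markovian_extension.
  move=> T [Tself sub _].
  by apply: self_adjoint_extension_unique.
Qed.
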